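(* Let $\phi$ be a positive continuous function on $(0,1)$ such that $g(x)=\int_x^1\frac{\phi^2(t)}{t}\,dt<\infty$ for all $0<x<1$. There is a constant $\gamma_1$ such that for every $f\in B_\phi$ with $f(0)=0$, $$\limsup_{r\to 1^-}\frac{|f(r\zeta)|}{\log|\log(1-r)|\,\sqrt{g(1-r^2)}}\le \gamma_1\|f\|_{B_\phi}$$ for almost all $\zeta\in T$.
   Context: $D=\{z\in\mathbb{C}:|z|<1\}$ is the open unit disk, $T=\{z\in\mathbb{C}:|z|=1\}$ is the unit circle, and ''almost all'' refers to normalized Lebesgue measure $m$ on $T$. For a positive continuous function $\phi$ on $(0,1)$, $B_\phi$ denotes the space of all analytic functions $f$ in $D$ with $$\|f\|_{B_\phi}=\sup_{z\in D,\ z\neq 0}\frac{(1-|z|^2)\,|f'(z)|}{\phi(1-|z|^2)}<\infty.$$ *)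

(* Defs.v *)
From HB Require Import structures.
From mathcomp Require Import all_boot all_order all_algebra.
From mathcomp Require Import complex.
From mathcomp Require Import all_classical all_reals all_analysis.

Set Implicit Arguments.
Unset Strict Implicit.
Unset Printing Implicit Defensive.

Import Order.TTheory GRing.Theory Num.Theory.
Import numFieldNormedType.Exports.

Local Open Scope classical_set_scope.
Local Open Scope ring_scope.
Local Open Scope complex_scope.

(* [normc z] is the modulus as an element of R; the generic norm of R[i] is
   the same number seen in R[i] ([normc_def]). *)
Notation normc := ComplexField.Normc.normc.

Definition unit_disk (R : realType) : set R[i] := [set z | normc z < 1].
Arguments unit_disk R : clear implicits.

(* Functions are total; only their values on the domain at hand matter.
   The codomain R[i]^o is R[i] as a normed module over itself, so that limits
   and [derive1] are complex ones. *)

(* Analytic: locally the sum of a convergent power series. *)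
Definition analytic_on (R : realType) (U : set R[i]) (f : R[i] -> R[i]^o) : Prop :=
  forall z0, U z0 -> exists (a : nat -> R[i]) (e : R), 0 < e /\
    forall z, normc (z - z0) < e ->
      series (fun n => a n * (z - z0) ^+ n : R[i]^o) @ \oo --> f z.

Definition Bnorm (R : realType) (phi : R -> R) (f : R[i] -> R[i]^o) : \bar R :=
  ereal_sup [set ((1 - normc z ^+ 2) * normc (derive1 f z)
                  / phi (1 - normc z ^+ 2))%:E
            | z in [set z | unit_disk R z /\ z <> 0]].

Definition Bspace (R : realType) (phi : R -> R) : set (R[i] -> R[i]^o) :=
  [set f | analytic_on (unit_disk R) f /\ (Bnorm phi f < +oo)%E].

(* Open at 1, since phi is only meaningful on (0,1). *)
Definition gint (R : realType) (phi : R -> R) (x : R) : \bar R :=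
  (\int[lebesgue_measure]_(t in `]x, 1%R[) (phi t ^+ 2 / t)%:E)%E.

Definition expi (R : realType) (t : R) : R[i] := cos t +i* sin t.

Lemma twopi_gt0 (R : realType) : 0 < 2 * pi :> R.
Proof. by rewrite mulr_gt0 ?pi_gt0. Qed.

(* Normalized Lebesgue measure on the unit circle is the image under [expi] of
   the uniform probability on [0, 2 pi]. *)
Definition circle_ae (R : realType) (P : R[i] -> Prop) : Prop :=
  {ae uniform_prob (twopi_gt0 R), forall t : R, P (expi t)}.

(* Main.v *)
Require Import Defs.
From HB Require Import structures.
From mathcomp Require Import all_boot all_order all_algebra.
From mathcomp Require Import complex.
From mathcomp Require Import all_classical all_reals all_analysis.
From mathcomp Require Import measurable_realfun.
From mathcomp Require Import ring lra.

Import Order.TTheory GRing.Theory Num.Theory.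
Import numFieldNormedType.Exports.

Local Open Scope classical_set_scope.
Local Open Scope ring_scope.
Local Open Scope complex_scope.

(** Write [F (s + i t) = f (e ^ (s + i t))] for [s < 0], and let [V] be the real
    or the imaginary part of [F], up to sign. Then [V] is harmonic, [2 pi]-periodic
    in [t], and its gradient is at most [w s = B log_weight phi s], where [B] is a
    bound for the norm of [f]. The function [g (1 - e ^ (2 s))] has derivative
    [2 (1 - e ^ (2 s)) (w s / B) ^ 2], so that, up to a constant, it dominates on
    [[-2, 0)] the double primitive of [(w / B) ^ 2] that vanishes to second order
    at [-2].

    Exponential integrability. Let [J s] be the integral of [e ^ (c V s t)] over
    [0 <= t <= 2 pi]. Formally [J'' = c ^ 2] times the integral of
    [|F'| ^ 2 e ^ (c V)], hence [J'' <= c ^ 2 w ^ 2 J]. If [K] is the maximum of [J]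
    on [[-2, s1]], then [J] minus a multiple of [K] times the double primitive of
    [c ^ 2 w ^ 2] is concave, and its values on [[-2, -1]] bound it further on. When
    [c ^ 2 B ^ 2 g] is small at [s1], this gives [K <= 4 K0], where [K0] is a bound
    for [J] on [[-2, -1]], hence depends only on the values of [f] on a fixed
    annulus and on an upper bound for [c] ([exp_mean_bound]). No derivative of [J]
    is taken: the inequality is used, with a worse constant, in the form of
    second symmetric differences ([exp_mean_second_difference]), a continuous
    function whose second symmetric differences are at most [o(h ^ 2)] being
    concave ([second_difference_concave]). The integral over a period is invariant under
    rotation, so the second difference of [J] is an integral of sums over four
    points [s + i t +- h], [s + i t +- i h]. For such sums harmonicity reads: the
    sum of the four increments of [V] is [o(h ^ 2)], uniformly in [t]. This follows
    from the local power series, term by term ([analytic_local_estimates],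
    [log_polar_harmonic_analytic]), and a compactness argument in [t]; no global
    power series and no contour integral is needed.

    Conclusion. Take [s_k = - 2 ^ -(k + 1)] and [c_k] of order
    [1 / (B sqrt (g (1 - e ^ (2 s_k))))]. By Markov's inequality and the
    Borel-Cantelli lemma, almost every [t] satisfies
    [V s_k t <= 2 log (k + 1) / c_k] for all large [k] ([dyadic_upper_bound]).
    Between [s_k] and [s_(k + 1)] the oscillation of [V] is at most
    [2 B sqrt g], by the inequality of arithmetic and geometric means applied to
    [w] ([dyadic_oscillation]); no regularity of [phi] is needed for this. Since
    [log |log (1 - r)|] is at least [log (k + 1) / 2] for [r >= e ^ s_k]
    and [k >= 3], the theorem follows, with the absolute constant 56. *)

Set Implicit Arguments.
Unset Strict Implicit.
Unset Printing Implicit Defensive.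

(** * Differentiation and comparison on the real line *)

Section real_derivatives.
Context {R : realType}.
Implicit Types (f g : R -> R) (a b c x : R).

Lemma is_derive1D f g x a b : is_derive x (1:R) f a -> is_derive x (1:R) g b ->
  is_derive x (1:R) (fun t => f t + g t) (a + b).
Proof. exact: is_deriveD. Qed.

Lemma is_derive1B f g x a b : is_derive x (1:R) f a -> is_derive x (1:R) g b ->
  is_derive x (1:R) (fun t => f t - g t) (a - b).
Proof. exact: is_deriveB. Qed.

Lemma is_derive1N f x a : is_derive x (1:R) f a ->
  is_derive x (1:R) (fun t => - f t) (- a).
Proof. exact: is_deriveN. Qed.

Lemma is_derive1M f g x a b : is_derive x (1:R) f a -> is_derive x (1:R) g b ->
  is_derive x (1:R) (fun t => f t * g t) (f x * b + g x * a).
Proof. exact: is_deriveM. Qed.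

Lemma is_derive1_cst c x : is_derive x (1:R) (fun=> c) 0.
Proof. exact: is_derive_cst. Qed.

Lemma is_derive1_id x : is_derive x (1:R) (fun t => t) 1.
Proof. exact: is_derive_id. Qed.

Lemma is_derive1_fcomp f g x a b : is_derive (g x) (1:R) f a ->
  is_derive x (1:R) g b -> is_derive x (1:R) (fun t => f (g t)) (a * b).
Proof. exact: is_derive1_comp. Qed.

Lemma is_derive1_expR x : is_derive x (1:R) expR (expR x).
Proof. exact: is_derive_expR. Qed.

Lemma is_derive1_linear c x : is_derive x (1:R) (fun t => c * t) c.
Proof.
apply: (is_derive_eq (is_derive1M (is_derive1_cst c x) (is_derive1_id x))).
by rewrite mulr1 mulr0 addr0.
Qed.

Lemma is_derive1P f x d : is_derive x (1:R) f d <->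
  forall e, 0 < e -> \forall h \near 0^', `|f (x + h) - f x - d * h| <= e * `|h|.
Proof.
have E : (fun h => h^-1 *: ((f \o shift x) (h *: (1:R)) - f x)) =
    (fun h => h^-1 * (f (x + h) - f x)).
  by apply/funext => h /=; rewrite [_%:A]mulr1 [h + x]addrC.
have eqh h : h != 0 ->
    `|d - h^-1 * (f (x + h) - f x)| * `|h| = `|f (x + h) - f x - d * h|.
  by move=> h0; rewrite -normrM distrC mulrBl mulrAC mulVf ?mul1r.
split=> [[cf df] e e0|dfe].
  have /cvgrPdist_le/(_ _ e0) : h^-1 * (f (x + h) - f x) @[h --> 0^'] --> d.
    by rewrite -E -df; exact: cf.
  move=> H; near=> h.
  have h0 : h != 0 by near: h; exact: nbhs_dnbhs_neq.
  by rewrite -eqh// ler_wpM2r//; near: h.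
have cf : h^-1 * (f (x + h) - f x) @[h --> 0^'] --> d.
  apply/cvgrPdist_le => e e0; have H := dfe _ e0; near=> h.
  have h0 : h != 0 by near: h; exact: nbhs_dnbhs_neq.
  by rewrite -(@ler_pM2r _ `|h|) ?normr_gt0// eqh//; near: h.
split; first by apply/cvg_ex; exists d; rewrite E.
by apply: cvg_lim => //; rewrite E.
Unshelve. all: by end_near. Qed.

(** Comparison of increments; it replaces the mean value inequality below. *)
Lemma le_derive_le f f' g g' a b : a <= b ->
  (forall x, a <= x <= b -> is_derive x (1:R) f (f' x)) ->
  (forall x, a <= x <= b -> is_derive x (1:R) g (g' x)) ->
  (forall x, a <= x <= b -> f' x <= g' x) ->
  f b - f a <= g b - g a.
Proof.
move=> ab df dg fg.
have dh x : a <= x <= b -> is_derive x (1:R) (g \- f) (g' x - f' x).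
  by move=> xab; apply: is_deriveB; [exact: dg|exact: df].
suff : (g \- f) a <= (g \- f) b by rewrite /=; lra.
apply: (@ger0_derive1_ndecr _ _ a b) => //.
- move=> x /[!in_itv]/= /andP[ax xb]; have xab : a <= x <= b by rewrite !ltW.
  by have [] := dh _ xab.
- move=> x /[!in_itv]/= /andP[ax xb]; have xab : a <= x <= b by rewrite !ltW.
  rewrite derive1E (derive_val (is_derive := dh _ xab)).
  by rewrite subr_ge0 fg.
- apply: derivable_within_continuous => x /[!in_itv]/= xab.
  by have [] := dh _ xab.
Qed.

Lemma is_derive1_near_right f x d : is_derive x (1:R) f d ->
  forall e, 0 < e -> \forall h \near 0^'+,
    `|f (x + h) - f x - d * h| <= e * h /\ `|f (x - h) - f x + d * h| <= e * h.
Proof.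
move=> /is_derive1P df e /df /= [r r0 H]; exists r => //= h /=.
rewrite sub0r normrN => hr h0; have /= := H h; have /= := H (- h).
rewrite !sub0r !normrN (gtr0_norm h0) oppr_eq0 gt_eqF// mulrN opprK.
by rewrite (gtr0_norm h0) in hr; move=> /(_ hr isT) ? /(_ hr isT) ?; split.
Qed.

Lemma is_derive1_continuous f x d :
  is_derive x (1:R) f d -> {for x, continuous f}.
Proof.
by case=> df _; exact/differentiable_continuous/derivable1_diffP.
Qed.

Lemma expR_le1DxD2sqr x : x <= 2^-1 -> expR x <= 1 + x + 2 * x ^+ 2.
Proof.
move=> x2; have := expR_ge1Dx (- x); rewrite expRN => ge1.
have x1 : 0 < 1 - x by lra.
have : expR x <= (1 - x)^-1.
  by rewrite -[leLHS]invrK lef_pV2// posrE ?invr_gt0 ?expR_gt0.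
move=> /le_trans; apply; rewrite -[leLHS]mul1r ler_pdivrMr//.
rewrite -subr_ge0.
have -> : (1 + x + 2 * x ^+ 2) * (1 - x) - 1 = x ^+ 2 * (1 - 2 * x) by ring.
by rewrite mulr_ge0 ?sqr_ge0//; lra.
Qed.

(** A continuous function whose second symmetric differences are at most
    [o(h ^ 2)] is concave: if it were below one of its chords, adding a small
    multiple of a concave parabola would produce an interior minimum with
    negative second difference. *)
Lemma second_difference_concave (v : R -> R) a m b : a < m -> m < b ->
  (forall x, a <= x <= b -> {for x, continuous v}) ->
  (forall s, a < s < b -> forall e, 0 < e -> \forall h \near 0^'+,
     v (s + h) + v (s - h) - 2 * v s <= e * h ^+ 2) ->
  v b <= v m + (b - m) * ((v m - v a) / (m - a)).
Proof.
move=> am mb cv Hv; rewrite leNgt; apply/negP => vb.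
have ma0 : 0 < m - a by rewrite subr_gt0.
have bm0 : 0 < b - m by rewrite subr_gt0.
have ba0 : 0 < b - a by lra.
pose k := (v b - v a) / (b - a).
have kE : k * (b - a) = v b - v a by rewrite /k divfK// gt_eqF.
pose D := v a + (m - a) * k - v m.
have D0 : 0 < D.
  have : 0 < (b - a) * D.
    have -> : (b - a) * D = (b - a) * (v a - v m) + (m - a) * (k * (b - a)).
      by rewrite /D; ring.
    rewrite kE; move: vb; rewrite -(ltr_pM2r ma0) mulrDl -!mulrA mulVf ?gt_eqF//.
    by rewrite mulr1; nra.
  by rewrite pmulr_rgt0.
pose n := D / (2 * (b - a) ^+ 2).
have n0 : 0 < n by rewrite divr_gt0// mulr_gt0// exprn_gt0.
have nE : n * (2 * (b - a) ^+ 2) = D.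
  by rewrite /n divfK// gt_eqF// mulr_gt0// exprn_gt0.
pose w t := v t + (- (v a + (t - a) * k) + n * (t - a) * (b - t)).
have wm : w m < 0.
  rewrite /w; suff : n * (m - a) * (b - m) < D by rewrite /D; lra.
  by rewrite -nE -mulrA ltr_pM2l//; nra.
have wa : w a = 0 by rewrite /w; ring.
have wb : w b = 0.
  have -> : w b = v b - v a - k * (b - a) by rewrite /w; ring.
  by rewrite kE subrr.
have cw : {within `[a, b], continuous w}.
  pose p t := - (v a + (t - a) * k) + n * (t - a) * (b - t).
  have cp : continuous p.
    by rewrite /p => t; exact: is_derive1_continuous.
  apply: continuous_in_subspaceT => t /[!inE]/= /[!in_itv]/= tab.
  by apply: (@continuousD _ _ _ v p); [exact: cv|exact: cp].
(* [w] vanishes at both ends and is negative at [m] *)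
have [c /[!in_itv]/= /andP[ac cb] wc] := EVT_min (ltW (lt_trans am mb)) cw.
have mI : m \in `[a, b] by rewrite in_itv/= !ltW.
have wcm := wc _ mI.
have ac' : a < c.
  by rewrite lt_neqAle ac andbT; apply/eqP => E; move: wcm; rewrite -E; lra.
have cb' : c < b.
  by rewrite lt_neqAle cb andbT; apply/eqP => E; move: wcm; rewrite E; lra.
have acb : a < c < b by rewrite ac' cb'.
have H := Hv _ acb _ n0.
near (0:R)^'+ => h.
have h0 : 0 < h by near: h; exact: nbhs_right_gt.
have h1 : h < c - a by near: h; apply: nbhs_right_lt; rewrite subr_gt0.
have h2 : h < b - c by near: h; apply: nbhs_right_lt; rewrite subr_gt0.
have : v (c + h) + v (c - h) - 2 * v c <= n * h ^+ 2 by near: h; exact: H.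
have W1 : w c <= w (c + h).
  by apply: wc; rewrite in_itv/=; clear - ac' cb' h0 h1 h2; lra.
have W2 : w c <= w (c - h).
  by apply: wc; rewrite in_itv/=; clear - ac' cb' h0 h1 h2; lra.
have nh : 0 < n * h ^+ 2 by rewrite mulr_gt0// exprn_gt0.
have -> : v (c + h) + v (c - h) - 2 * v c =
  (w (c + h) - w c) + (w (c - h) - w c) + 2 * (n * h ^+ 2) by rewrite /w; ring.
by clear - W1 W2 nh; lra.
Unshelve. all: by end_near. Qed.

Lemma primitive_exists f a b c : a < c ->
  (forall x, a < x < b -> {for x, continuous f}) ->
  exists F : R -> R, forall x, c < x < b -> is_derive x (1:R) F (f x).
Proof.
move=> ac cf; exists (fun x => \int[lebesgue_measure]_(t in `[c, x]) f t).
move=> x /andP[cx xb].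
have xu : x < (x + b) / 2 by lra.
have fi : lebesgue_measure.-integrable `[c, (x + b) / 2] (EFin \o f).
  apply: continuous_compact_integrable; first exact: segment_compact.
  apply: continuous_in_subspaceT => y /[!inE]/= /[!in_itv]/= /andP[cy yb].
  by apply: cf; lra.
have axb : a < x < b by lra.
have [dF FE] := continuous_FTC1_closed xu fi cx (cf _ axb).
by split; [exact: dF|rewrite -derive1E].
Qed.

Lemma second_difference_ge (Q P : R -> R) s l : is_derive s (1:R) P l ->
  (\forall x \near s, is_derive x (1:R) Q (P x)) ->
  forall e, 0 < e -> \forall h \near 0^'+,
    (l - e) * h ^+ 2 <= Q (s + h) + Q (s - h) - 2 * Q s.
Proof.
move=> dP [r /= r0 dQ] e e0; have [d /= d0 HP] := is_derive1_near_right dP e0.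
near=> h.
have h0 : 0 < h by near: h; exact: nbhs_right_gt.
have hd : h < d by near: h; exact: nbhs_right_lt.
have hr : h < r by near: h; exact: nbhs_right_lt.
pose G x := Q (s + x) + Q (s - x).
pose q x := (l - e) * x ^+ 2.
have H : q h - q 0 <= G h - G 0.
  apply: (@le_derive_le _ (fun x => 2 * (l - e) * x) _
    (fun x => P (s + x) - P (s - x))); first exact: ltW.
  - move=> x _; have H := is_derive1M (is_derive1_cst (l - e) x)
      (is_derive1M (is_derive1_id x) (is_derive1_id x)).
    by apply: (is_derive_eq H); rewrite /GRing.scale/=; ring.
  - move=> x /andP[x0 xh].
    have d1 : is_derive (s + x) (1:R) Q (P (s + x)).
      by apply: dQ; rewrite /= opprD addNKr normrN ger0_norm//; lra.
    have d2 : is_derive (s - x) (1:R) Q (P (s - x)).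
      by apply: dQ; rewrite /= opprB addrCA subrr addr0 ger0_norm//; lra.
    have H := is_derive1D
      (is_derive1_fcomp (g := fun x => s + x) d1
        (is_derive1D (is_derive1_cst s x) (is_derive1_id x)))
      (is_derive1_fcomp (g := fun x => s - x) d2
        (is_derive1B (is_derive1_cst s x) (is_derive1_id x))).
    by apply: (is_derive_eq H); ring.
  - move=> x /andP[]; rewrite le_eqVlt => /predU1P[<- _|x0 xh].
      by rewrite addr0 subr0 subrr mulr0.
    have := HP x; rewrite /= sub0r normrN gtr0_norm// => /(_ (le_lt_trans xh hd) x0).
    rewrite !ler_norml => -[/andP[A1 A2] /andP[A3 A4]]; nra.
move: H; rewrite /G /q subr0 addr0 expr0n/= mulr0 subr0.
by move=> /le_trans; apply; lra.
Unshelve. all: by end_near. Qed.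

End real_derivatives.

(** * Integrals of periodic continuous functions *)

Section periodic_integral.
Context {R : realType}.
Implicit Types (f g : R -> R).

Local Notation mu := (@lebesgue_measure R).
Local Notation Iper := (`[0, 2 * pi]%classic : set R).

Lemma period_integrable f : continuous f -> mu.-integrable Iper (EFin \o f).
Proof.
move=> cf; apply: continuous_compact_integrable; first exact: segment_compact.
exact: continuous_subspaceT.
Qed.

Lemma period_integralD f g : continuous f -> continuous g ->
  \int[mu]_(t in Iper) (f t + g t) =
  \int[mu]_(t in Iper) f t + \int[mu]_(t in Iper) g t.
Proof. by move=> cf cg; rewrite RintegralD//; exact: period_integrable. Qed.

Lemma period_integralZl c f : continuous f ->
  \int[mu]_(t in Iper) (c * f t) = c * \int[mu]_(t in Iper) f t.
Proof. by move=> cf; rewrite RintegralZl//; exact: period_integrable. Qed.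

Lemma le_period_integral f g : continuous f -> continuous g ->
  (forall t, 0 <= t <= 2 * pi -> f t <= g t) ->
  \int[mu]_(t in Iper) f t <= \int[mu]_(t in Iper) g t.
Proof.
by move=> cf cg fg; apply: le_Rintegral => //; exact: period_integrable.
Qed.

(** With [U] a primitive of [f], the function [U (2 pi + h) - U h] is constant. *)
Lemma period_integral_shift f h : continuous f ->
  (forall t, f (t + 2 * pi) = f t) ->
  \int[mu]_(t in Iper) f (t + h) = \int[mu]_(t in Iper) f t.
Proof.
move=> cf pf.
have p0 : 0 < 2 * pi :> R by exact: twopi_gt0.
have h0 : 0 <= `|h| by [].
have a1 : - `|h| - 2 < - `|h| - 1 by lra.
have [U dU] := @primitive_exists _ f (- `|h| - 2) (2 * pi + `|h| + 1) _ a1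
  (fun x _ => cf x).
have hle : - `|h| <= h <= `|h| by rewrite -ler_norml.
have int_shift k : - `|h| <= k <= `|h| ->
    \int[mu]_(t in Iper) f (t + k) = U (2 * pi + k) - U k.
  move=> /andP[k1 k2].
  have dUk t : 0 <= t <= 2 * pi ->
      is_derive t (1:R) (fun t => U (t + k)) (f (t + k)).
    move=> /andP[t0 t1].
    have dUt : is_derive (t + k) (1:R) U (f (t + k)).
      by apply: dU; clear - k1 k2 t0 t1; apply/andP; split; lra.
    have H := is_derive1_fcomp (g := fun t => t + k) dUt
      (is_derive1D (is_derive1_id t) (is_derive1_cst k t)).
    by apply: (is_derive_eq H); rewrite addr0 mulr1.
  have cfk : {within Iper, continuous (fun t => f (t + k))}.
    apply: continuous_subspaceT => t.
    apply: continuous_comp; last exact: cf.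
    by apply: cvgD; [exact: cvg_id|exact: cvg_cst].
  rewrite /Rintegral (@continuous_FTC2 _ _ (fun t => U (t + k)))//.
  - by rewrite add0r.
  - have cU t : 0 <= t <= 2 * pi -> {for t, continuous (fun t => U (t + k))}.
      by move=> /dUk; exact: is_derive1_continuous.
    split.
    + move=> t /[!in_itv]/= /andP[t0 t1].
      by have [] := dUk t; rewrite ?(ltW t0) ?ltW.
    + by apply: cvg_at_right_filter; apply: cU; rewrite lexx ltW.
    + by apply: cvg_at_left_filter; apply: cU; rewrite lexx ltW.
  - move=> t /[!in_itv]/= /andP[t0 t1]; rewrite derive1E; apply: derive_val.
    by apply: dUk; rewrite !ltW.
have dd k : - `|h| <= k <= `|h| ->
    is_derive k (1:R) (fun k => U (2 * pi + k) - U k) 0.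
  move=> /andP[k1 k2].
  have dU1 : is_derive k (1:R) U (f k).
    by apply: dU; clear - k1 k2 p0; apply/andP; split; lra.
  have dU2 : is_derive (2 * pi + k) (1:R) U (f (2 * pi + k)).
    by apply: dU; clear - k1 k2 p0; apply/andP; split; lra.
  have H := is_derive1B (is_derive1_fcomp (g := fun k => 2 * pi + k) dU2
    (is_derive1D (is_derive1_cst (2 * pi) k) (is_derive1_id k))) dU1.
  by apply: (is_derive_eq H); rewrite [2 * pi + k]addrC pf add0r mulr1 subrr.
under [RHS]eq_Rintegral do rewrite -[X in f X]addr0.
rewrite int_shift// int_shift//; last by rewrite oppr_le0 h0.
have const a b : - `|h| <= a -> a <= b -> b <= `|h| ->
    U (2 * pi + b) - U b = U (2 * pi + a) - U a.
  move=> ha ab hb.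
  have dab x : a <= x <= b -> is_derive x (1:R) (fun k => U (2 * pi + k) - U k) 0.
    by move=> /andP[ax xb]; apply: dd; rewrite (le_trans ha ax) (le_trans xb hb).
  have d0 x : a <= x <= b -> is_derive x (1:R) (fun=> 0 : R) 0.
    by move=> _; exact: is_derive1_cst.
  have le0 (x : R) : a <= x <= b -> (0:R) <= 0 by [].
  have A1 := le_derive_le ab dab d0 le0.
  have A2 := le_derive_le ab d0 dab le0.
  by clear - A1 A2; move: A1 A2; rewrite subrr; lra.
have /andP[hl hu] := hle.
have [h1|/ltW h1] := leP 0 h; last by apply/esym/const.
by apply: const; rewrite // oppr_le0.
Qed.

End periodic_integral.

(** * Exponential means of a function with controlled gradient *)

(** The properties of [V s t], the real or imaginary part of
    [f (e ^ (s + i t))], on which the probabilistic estimate rests: periodicity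
    in the angle [t], the gradient bound [w s], and a form of harmonicity, the
    mean value property over four points up to [o(h ^ 2)], uniformly in [t]. *)
Record log_polar_harmonic {R : realType} (V : R -> R -> R) (w : R -> R) : Prop :=
  LogPolarHarmonic {
  lph_periodic : forall s t, V s (t + 2 * pi) = V s t ;
  lph_radial : forall s t : R, s < 0 ->
    exists2 d, is_derive s (1:R) (V^~ t) d & `|d| <= w s ;
  lph_angular : forall s t : R, s < 0 ->
    exists2 d, is_derive t (1:R) (V s) d & `|d| <= w s ;
  lph_mean : forall s e : R, s < 0 -> 0 < e -> \forall h \near 0^'+,
    forall t : R, 0 <= t <= 2 * pi ->
    `|V (s + h) t + V (s - h) t + V s (t + h) + V s (t - h) - 4 * V s t|
      <= e * h ^+ 2 }.

Lemma log_polar_harmonicN {R : realType} (V : R -> R -> R) (w : R -> R) :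
  log_polar_harmonic V w -> log_polar_harmonic (fun s t => - V s t) w.
Proof.
case=> per rad ang mean; split.
- by move=> s t; rewrite per.
- move=> s t /(rad s t)[d dV dw]; exists (- d); last by rewrite normrN.
  exact: is_derive1N.
- move=> s t /(ang s t)[d dV dw]; exists (- d); last by rewrite normrN.
  exact: is_derive1N.
- move=> s e s0 e0; apply: filterS (mean s e s0 e0) => h H t t2pi.
  rewrite -normrN; apply: le_trans (H t t2pi).
  by rewrite le_eqVlt; apply/orP; left; apply/eqP; congr (`|_|); ring.
Qed.

Section oscillation.
Context {R : realType}.

Lemma lph_radial_osc (V : R -> R -> R) (w : R -> R) (lphV : log_polar_harmonic V w)
    (p p' : R -> R) (a b t : R) : a <= b -> b < 0 ->
  (forall x, a <= x <= b -> is_derive x (1:R) p (p' x)) ->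
  (forall x, a <= x <= b -> w x <= p' x) ->
  `|V b t - V a t| <= p b - p a.
Proof.
move=> ab b0 dp wp.
have dV x : a <= x <= b -> is_derive x (1:R) (V^~ t) ('D_1 (V^~ t) x) /\
    `|'D_1 (V^~ t) x| <= w x.
  move=> /andP[ax xb]; have [d dV dw] := lph_radial lphV t (le_lt_trans xb b0).
  by rewrite (derive_val (is_derive := dV)).
have dV1 x (xab : a <= x <= b) := (dV x xab).1.
rewrite ler_norml; apply/andP; split.
  rewrite lerNl opprB.
  have dp1 x : a <= x <= b -> is_derive x (1:R) (fun x => - p x) (- p' x).
    by move=> /dp; exact: is_derive1N.
  have := le_derive_le ab dp1 dV1.
  suff H : forall x, a <= x <= b -> - p' x <= 'D_1 (V^~ t) x.
    by move=> /(_ H); lra.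
  move=> x xab; have [_] := dV x xab; rewrite ler_norml => /andP[+ _].
  by apply: le_trans; rewrite lerN2 wp.
apply: (le_derive_le ab dV1 dp) => x xab; have [_] := dV x xab.
by rewrite ler_norml => /andP[_ /le_trans]; apply; exact: wp.
Qed.

Lemma lph_angular_osc (V : R -> R -> R) (w : R -> R) (lphV : log_polar_harmonic V w)
    (s t t' : R) : s < 0 -> `|V s t' - V s t| <= w s * `|t' - t|.
Proof.
move=> s0; wlog tt' : t t' / t <= t'.
  move=> H; have [|/ltW] := leP t t'; first exact: H.
  by rewrite distrC [`|t' - t|]distrC; exact: H.
rewrite [`|t' - t|]ger0_norm ?subr_ge0//.
have dV x : t <= x <= t' -> is_derive x (1:R) (V s) ('D_1 (V s) x).
  move=> _; have [d dV _] := lph_angular lphV x s0.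
  by rewrite (derive_val (is_derive := dV)).
have Vw x : `|'D_1 (V s) x| <= w s.
  have [d dV' ?] := lph_angular lphV x s0.
  by rewrite (derive_val (is_derive := dV')).
have dl k x : t <= x <= t' -> is_derive x (1:R) (fun x => k * x) k.
  by move=> _; exact: is_derive1_linear.
rewrite ler_norml; apply/andP; split.
  have := le_derive_le tt' (dl (- w s)) dV.
  suff H : forall x, t <= x <= t' -> - w s <= 'D_1 (V s) x.
    by move=> /(_ H); lra.
  by move=> x _; have := Vw x; rewrite ler_norml => /andP[].
rewrite mulrBr; apply: (le_derive_le tt' dV (dl (w s))) => x _.
by have := Vw x; rewrite ler_norml => /andP[].
Qed.

Lemma lph_local_lipschitz (V : R -> R -> R) (w : R -> R)
    (lphV : log_polar_harmonic V w)
    (w_cont : forall s : R, s < 0 -> {for s, continuous w})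
    (s e : R) : s < 0 -> 0 < e -> \forall h \near 0^'+,
  forall t, `|V (s + h) t - V s t| <= (w s + e) * h /\
    `|V (s - h) t - V s t| <= (w s + e) * h.
Proof.
move=> s0 e0; have /cvgrPdist_le/(_ _ e0)[r /= r0 wr] := w_cont _ s0.
near=> h => t.
have h0 : 0 < h by near: h; exact: nbhs_right_gt.
have hs : h < - s by near: h; apply: nbhs_right_lt; rewrite oppr_gt0.
have hr : h < r by near: h; apply: nbhs_right_lt.
have wle x : s - h <= x <= s + h -> w x <= w s + e.
  move=> /andP[x1 x2]; have := wr x; rewrite /= => H.
  have : `|s - x| < r.
    apply: le_lt_trans hr; rewrite ler_norml.
    by clear -x1 x2; apply/andP; split; lra.
  by move=> /H; rewrite ler_norml; clear; lra.
have shs : s <= s + h by rewrite lerDl ltW.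
have shs' : s - h <= s by rewrite gerBl ltW.
split.
  have := @lph_radial_osc V w lphV (fun x => (w s + e) * x) (fun=> w s + e)
    s (s + h) t shs.
  have sh0 : s + h < 0 by clear -hs; lra.
  move=> /(_ sh0 (fun x _ => is_derive1_linear _ x)).
  have -> : (w s + e) * (s + h) - (w s + e) * s = (w s + e) * h by ring.
  by apply => x /andP[x1 x2]; apply: wle; rewrite (le_trans shs')// x2.
rewrite distrC.
have := @lph_radial_osc V w lphV (fun x => (w s + e) * x) (fun=> w s + e)
  (s - h) s t shs' s0.
move=> /(_ (fun x _ => is_derive1_linear _ x)).
have -> : (w s + e) * s - (w s + e) * (s - h) = (w s + e) * h by ring.
by apply => x /andP[x1 x2]; apply: wle; rewrite x1 (le_trans x2).
Unshelve. all: by end_near. Qed.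

Lemma lph_continuous_angle (V : R -> R -> R) (w : R -> R)
    (lphV : log_polar_harmonic V w)
    (s : R) : s < 0 -> continuous (V s).
Proof.
move=> s0 t; have [d dV _] := lph_angular lphV t s0.
exact: is_derive1_continuous dV.
Qed.

End oscillation.

Section exponential_means.
Context {R : realType}.

Local Notation mu := (@lebesgue_measure R).
Local Notation Iper := (`[0, 2 * pi]%classic : set R).

(** The integral of [e ^ (c V)] over the angles of the circle of radius [e ^ s],
    not divided by [2 pi]. *)
Definition exp_mean (V : R -> R -> R) (c s : R) :=
  \int[mu]_(t in Iper) expR (c * V s t).

Lemma exp_cont (V : R -> R -> R) (w : R -> R) (lphV : log_polar_harmonic V w)
    (c s : R) : s < 0 -> continuous (fun t => expR (c * V s t)).
Proof.
move=> s0 t; apply: continuous_comp; last exact: continuous_expR.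
by apply: cvgM; [exact: cvg_cst|exact: (lph_continuous_angle lphV s0)].
Qed.

Lemma exp_mean_ge0 (V : R -> R -> R) c s : 0 <= exp_mean V c s.
Proof. by apply: Rintegral_ge0 => t _; exact: expR_ge0. Qed.

(** Four-point inequality before integration, from [e ^ x <= 1 + x + 2 x ^ 2]
    applied to the four increments of [c V]. *)
Lemma exp_four_points (V : R -> R -> R) (w : R -> R) (lphV : log_polar_harmonic V w)
    (w_ge0 : forall s : R, s < 0 -> 0 <= w s)
    (w_cont : forall s : R, s < 0 -> {for s, continuous w})
    (c s e : R) : 0 <= c -> s < 0 -> 0 < e ->
  \forall h \near 0^'+, forall t : R, 0 <= t <= 2 * pi ->
    expR (c * V (s + h) t) + expR (c * V (s - h) t) +
    (expR (c * V s (t + h)) + expR (c * V s (t - h))) <=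
    (4 + (c * e + 8 * c ^+ 2 * (w s + e) ^+ 2) * h ^+ 2) * expR (c * V s t).
Proof.
move=> c0 s0 e0.
have ws : 0 <= w s by exact: w_ge0.
have M0 : 0 < 2 * (c + 1) * (w s + e) by rewrite !mulr_gt0//; lra.
near=> h => t tI.
have h0 : 0 < h by near: h; exact: nbhs_right_gt.
have hM : h < (2 * (c + 1) * (w s + e))^-1.
  by near: h; apply: nbhs_right_lt; rewrite invr_gt0.
have [L1 L2] : `|V (s + h) t - V s t| <= (w s + e) * h /\
    `|V (s - h) t - V s t| <= (w s + e) * h.
  by move: t tI; near: h; apply: filterS (lph_local_lipschitz lphV w_cont s0 e0).
have mean : `|V (s + h) t + V (s - h) t + V s (t + h) + V s (t - h) - 4 * V s t|
    <= e * h ^+ 2.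
  move: t tI L1 L2; near: h; apply: filterS (lph_mean lphV s0 e0) => h H t tI _ _.
  exact: H.
have L3 : `|V s (t + h) - V s t| <= (w s + e) * h.
  apply: (le_trans (lph_angular_osc lphV _ _ s0)).
  rewrite addrC addKr gtr0_norm//; apply: ler_wpM2r; first exact: ltW.
  by rewrite lerDl ltW.
have L4 : `|V s (t - h) - V s t| <= (w s + e) * h.
  apply: (le_trans (lph_angular_osc lphV _ _ s0)).
  rewrite addrC addKr normrN gtr0_norm//; apply: ler_wpM2r; first exact: ltW.
  by rewrite lerDl ltW.
(* [h] is so small that the increments of [c V] are at most [1 / 2] *)
have key x : `|x| <= (w s + e) * h ->
    expR (c * (V s t + x)) <= expR (c * V s t) *
      (1 + c * x + 2 * (c ^+ 2 * (w s + e) ^+ 2 * h ^+ 2)).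
  move=> xh; rewrite mulrDr expRD; apply: ler_wpM2l; first exact: expR_ge0.
  apply: (le_trans (expR_le1DxD2sqr _)).
    clear - xh hM M0 c0 h0 ws e0.
    have : h * (2 * (c + 1) * (w s + e)) < 1 by rewrite -ltr_pdivlMr// div1r.
    have : c * x <= c * ((w s + e) * h).
      by apply: ler_wpM2l => //; apply: le_trans xh; exact: ler_norm.
    have : 0 <= h * (w s + e) by rewrite mulr_ge0 ?ltW//; lra.
    by clear; nra.
  rewrite lerD2l ler_pM2l// exprMn -mulrA ler_wpM2l ?sqr_ge0//.
  by rewrite -exprMn -(real_normK (num_real x)) lerXn2r// nnegrE (le_trans _ xh).
have E a : V s t + (a - V s t) = a by rewrite addrC subrK.
have := key _ L1; have := key _ L2; have := key _ L3; have := key _ L4.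
rewrite !E.
move: mean; rewrite ler_norml => /andP[_ mean].
have := ler_wpM2l c0 mean.
have := expR_gt0 (c * V s t).
move: (expR (c * V s t)) (expR (c * V (s + h) t)) (expR (c * V (s - h) t))
  (expR (c * V s (t + h))) (expR (c * V s (t - h))) => u u1 u2 u3 u4 u0 m4 k4 k3 k2 k1.
have := ler_wpM2l (ltW u0) m4.
clear - k1 k2 k3 k4.
move: (V (s + h) t) (V (s - h) t) (V s (t + h)) (V s (t - h)) (V s t) k1 k2 k3 k4.
move=> v1 v2 v3 v4 v k1 k2 k3 k4 k5.
apply: (le_trans (lerD (lerD k1 k2) (lerD k3 k4))).
apply: le_trans (_ : 4 * u + u * (c * (v1 + v2 + v3 + v4 - 4 * v)) +
  8 * c ^+ 2 * (w s + e) ^+ 2 * h ^+ 2 * u <= _).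
  by rewrite le_eqVlt; apply/orP; left; apply/eqP; ring.
have -> : (4 + (c * e + 8 * c ^+ 2 * (w s + e) ^+ 2) * h ^+ 2) * u =
  4 * u + u * (c * (e * h ^+ 2)) + 8 * c ^+ 2 * (w s + e) ^+ 2 * h ^+ 2 * u by ring.
by rewrite lerD2r lerD2l.
Unshelve. all: by end_near. Qed.

(** By rotation invariance, the two points at the same radius contribute twice
    the mean itself when the four-point inequality is integrated; there remains
    the second difference in the radial direction. *)
Lemma exp_mean_second_difference (V : R -> R -> R) (w : R -> R)
    (lphV : log_polar_harmonic V w)
    (w_ge0 : forall s : R, s < 0 -> 0 <= w s)
    (w_cont : forall s : R, s < 0 -> {for s, continuous w})
    (c s e : R) : 0 <= c -> s < 0 -> 0 < e ->
  \forall h \near 0^'+,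
    exp_mean V c (s + h) + exp_mean V c (s - h) - 2 * exp_mean V c s <=
    (8 * c ^+ 2 * w s ^+ 2 * exp_mean V c s + e) * h ^+ 2.
Proof.
move=> c0 s0 e0.
have ws : 0 <= w s by exact: w_ge0.
have J0 := exp_mean_ge0 V c s.
set J := exp_mean V c s in J0 *.
pose M := (c + 8 * c ^+ 2 * (2 * w s + 1)) * J + 1.
have c20 : 0 <= 8 * c ^+ 2 by rewrite mulr_ge0// sqr_ge0.
have M0 : 0 < M.
  by rewrite ltr_wpDl// mulr_ge0// addr_ge0// mulr_ge0// addr_ge0// mulr_ge0.
(* the four-point inequality with error [e1] costs at most [e1 * M <= e] *)
pose e1 := Num.min 1 (e / M).
have e10 : 0 < e1 by rewrite lt_min ltr01 divr_gt0.
have e11 : e1 <= 1 by rewrite ge_min lexx.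
have e1M : e1 * M <= e by rewrite -ler_pdivlMr// ge_min lexx orbT.
near=> h.
have h0 : 0 < h by near: h; exact: nbhs_right_gt.
have hs : h < - s by near: h; apply: nbhs_right_lt; rewrite oppr_gt0.
have s1 : s + h < 0 by clear -hs; lra.
have s2 : s - h < 0 by clear -s0 h0; lra.
have four : forall t, 0 <= t <= 2 * pi ->
    expR (c * V (s + h) t) + expR (c * V (s - h) t) +
    (expR (c * V s (t + h)) + expR (c * V s (t - h))) <=
    (4 + (c * e1 + 8 * c ^+ 2 * (w s + e1) ^+ 2) * h ^+ 2) * expR (c * V s t).
  by near: h; exact: (exp_four_points lphV).
have cshift k : continuous (fun t => expR (c * V s (t + k))).
  move=> t; apply: (@continuous_comp _ _ _ (fun t => t + k)
    (fun t => expR (c * V s t))); last exact: (exp_cont lphV).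
  by apply: cvgD; [exact: cvg_id|exact: cvg_cst].
have cD (f g : R -> R) :
    continuous f -> continuous g -> continuous (fun t => f t + g t).
  by move=> cf cg t; apply: cvgD; [exact: cf|exact: cg].
have shift k : \int[mu]_(t in Iper) expR (c * V s (t + k)) = J.
  apply: (@period_integral_shift _ (fun t => expR (c * V s t))).
    exact: (exp_cont lphV).
  by move=> t; rewrite (lph_periodic lphV).
have ce k : k < 0 -> continuous (fun t => expR (c * V k t)).
  by move=> k0; exact: (exp_cont lphV).
have c12 := cD _ _ (ce _ s1) (ce _ s2).
have c34 := cD _ _ (cshift h) (cshift (- h)).
have cr : continuous (fun t => (4 + (c * e1 + 8 * c ^+ 2 * (w s + e1) ^+ 2) *
    h ^+ 2) * expR (c * V s t)).
  by move=> t; apply: cvgM; [exact: cvg_cst|exact: (exp_cont lphV)].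
have := le_period_integral (cD _ _ c12 c34) cr four.
rewrite period_integralZl; last exact: (exp_cont lphV).
rewrite (period_integralD c12 c34).
rewrite (period_integralD (ce _ s1) (ce _ s2)).
rewrite (period_integralD (cshift h) (cshift (- h))).
rewrite (shift h) (shift (- h)).
rewrite -/(exp_mean V c (s + h)) -/(exp_mean V c (s - h)) -/(exp_mean V c s) -/J.
set X := (4 + _); set Y := exp_mean V c (s + h); set Z := exp_mean V c (s - h).
move=> H.
have -> : Y + Z - 2 * J = (Y + Z + (J + J)) - 4 * J by ring.
apply: (le_trans (lerB H (lexx (4 * J)))).
have -> : X * J - 4 * J = (c * e1 + 8 * c ^+ 2 * (w s + e1) ^+ 2) * J * h ^+ 2.
  by rewrite /X; ring.
apply: ler_wpM2r; first exact: sqr_ge0.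
apply: le_trans (_ : 8 * c ^+ 2 * w s ^+ 2 * J + e1 * M <= _); last by rewrite lerD2l.
have -> : 8 * c ^+ 2 * w s ^+ 2 * J + e1 * M =
  (c * e1 + 8 * c ^+ 2 * (w s ^+ 2 + e1 * (2 * w s + 1))) * J + e1 by rewrite /M; ring.
rewrite -[leLHS]addr0; apply: lerD; last exact: ltW.
apply: ler_wpM2r => //; rewrite lerD2l; apply: ler_wpM2l => //.
have -> : (w s + e1) ^+ 2 = w s ^+ 2 + e1 * (2 * w s + e1) by ring.
by rewrite lerD2l; apply: ler_wpM2l; [exact: ltW|rewrite lerD2l].
Unshelve. all: by end_near. Qed.

End exponential_means.

Section exp_mean_bound.
Context {R : realType}.

Local Notation mu := (@lebesgue_measure R).
Local Notation Iper := (`[0, 2 * pi]%classic : set R).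

Lemma exp_mean_continuous (V : R -> R -> R) (w : R -> R)
    (lphV : log_polar_harmonic V w)
    (w_ge0 : forall s : R, s < 0 -> 0 <= w s)
    (w_cont : forall s : R, s < 0 -> {for s, continuous w}) (c s : R) :
  0 <= c -> s < 0 -> {for s, continuous (exp_mean V c)}.
Proof.
move=> c0 s0.
have ws : 0 <= w s by exact: w_ge0.
(* the logarithm of the mean is locally Lipschitz with constant [L] *)
pose L := c * (w s + 1).
have lip : \forall x \near s, forall t, `|V x t - V s t| <= (w s + 1) * `|x - s|.
  have [r /= r0 H] := lph_local_lipschitz lphV w_cont s0 ltr01.
  exists r => //= x /= xr t.
  have [xs|xs|->] := ltrgtP x s; last by rewrite !subrr !normr0 mulr0.
  - have := H (s - x); rewrite /= sub0r normrN => /(_ xr).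
    rewrite subr_gt0 => /(_ xs t)[_].
    by rewrite opprB addrCA subrr addr0.
  - have := H (x - s); rewrite /= sub0r normrN distrC => /(_ xr).
    rewrite subr_gt0 => /(_ xs t)[+ _].
    by rewrite addrCA subrr addr0.
have cE : expR (L * `|x - s|) @[x --> s] --> (1:R).
  have -> : (1:R) = expR (L * `|s - s|) by rewrite subrr normr0 mulr0 expR0.
  apply: (@continuous_comp _ _ _ (fun x => L * `|x - s|) expR);
    last exact: continuous_expR.
  apply: cvgM; first exact: cvg_cst.
  apply: cvg_norm; apply: cvgB; [exact: cvg_id|exact: cvg_cst].
have J0 := exp_mean_ge0 V c s.
apply/cvgrPdist_le => e e0.
have e1 : 0 < e / (exp_mean V c s + 1) by rewrite divr_gt0// ltr_wpDl.
have /cvgrPdist_le/(_ _ e1) cE1 := cE.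
have xneg : \forall x \near s, x < 0 by exact: lt_nbhsl.
near=> x.
have x0 : x < 0 by near: x.
have Lx : forall t, `|V x t - V s t| <= (w s + 1) * `|x - s| by near: x.
have EE : `|1 - expR (L * `|x - s|)| <= e / (exp_mean V c s + 1) by near: x.
set E := expR (L * `|x - s|) in EE.
have E1 : 1 <= E by rewrite -expR0 ler_expR !mulr_ge0// addr_ge0.
have {}EE : E - 1 <= e / (exp_mean V c s + 1).
  by apply: le_trans EE; rewrite distrC ler_norm.
have cx k : k < 0 -> continuous (fun t => expR (c * V k t)).
  by move=> k0; exact: (exp_cont lphV).
have cM (f : R -> R) k : continuous f -> continuous (fun t => k * f t).
  by move=> cf t; apply: cvgM; [exact: cvg_cst|exact: cf].
have up a b : a <= b + (w s + 1) * `|x - s| -> expR (c * a) <= E * expR (c * b).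
  move=> ab; rewrite /E -expRD ler_expR /L -mulrA -mulrDr addrC.
  exact: ler_wpM2l.
have J1 : exp_mean V c x <= E * exp_mean V c s.
  rewrite -period_integralZl; last exact: cx.
  apply: le_period_integral; [exact: cx|exact: cM (cx _ s0)|] => t _.
  by apply: up; have := Lx t; rewrite ler_norml lerBlDl => /andP[].
have J2 : exp_mean V c s <= E * exp_mean V c x.
  rewrite -period_integralZl; last exact: cx.
  apply: le_period_integral; [exact: cx|exact: cM (cx _ x0)|] => t _.
  by apply: up; have := Lx t; rewrite distrC ler_norml lerBlDl => /andP[].
have J3 := exp_mean_ge0 V c x.
have EJ : (E - 1) * exp_mean V c s <= e.
  apply: (le_trans (ler_wpM2r J0 EE)).
  rewrite mulrAC -mulrA ler_piMr//; first exact: ltW.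
  by rewrite ler_pdivrMr ?ltr_wpDl// mul1r lerDl.
rewrite ler_norml; apply/andP; split.
  by rewrite lerNl opprB; apply: le_trans EJ; rewrite mulrBl mul1r lerD2r.
have [Jx|/ltW Jx] := leP (exp_mean V c s) (exp_mean V c x).
  by apply: (@le_trans _ _ 0); [rewrite subr_le0|exact: ltW].
apply: le_trans EJ.
apply: (@le_trans _ _ ((E - 1) * exp_mean V c x)).
  by rewrite mulrBl mul1r lerD2r.
by apply: ler_wpM2l => //; rewrite subr_ge0.
Unshelve. all: by end_near. Qed.

(** The exponential mean at [s1] is controlled by its values at the radii
    [e ^ -2] to [e ^ -1], as soon as the double primitive [Q] of [w ^ 2] satisfies
    [8 c ^ 2 Q s1 <= 1 / 2]. If [K] is the maximum of the mean over [[-2, s1]],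
    then the mean minus [8 c ^ 2 K Q] is concave, which bounds [K] by
    [2 K0 + K / 2]. *)
Lemma exp_mean_bound (V : R -> R -> R) (w Q P : R -> R)
    (lphV : log_polar_harmonic V w)
    (w_ge0 : forall s : R, s < 0 -> 0 <= w s)
    (w_cont : forall s : R, s < 0 -> {for s, continuous w})
    (dQ : forall s : R, -3 < s < 0 -> is_derive s (1:R) Q (P s))
    (dP : forall s : R, -3 < s < 0 -> is_derive s (1:R) P (w s ^+ 2))
    (Q0 : Q (-2) = 0) (P0 : P (-2) = 0) (c s1 K0 : R) :
  -1 < s1 < 0 -> 0 <= c -> 8 * c ^+ 2 * Q s1 <= 2^-1 ->
  (forall s, -2 <= s <= -1 -> exp_mean V c s <= K0) ->
  exp_mean V c s1 <= 4 * K0.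
Proof.
move=> /andP[s11 s10] c0 cQ JK0.
have d0 (x : R) : is_derive x (1:R) (fun=> 0 : R) 0 by exact: is_derive1_cst.
have P_ge0 s : -2 <= s < 0 -> 0 <= P s.
  move=> /andP[s2 s0].
  have := @le_derive_le _ (fun=> 0) (fun=> 0) P (fun s => w s ^+ 2) (-2) s s2.
  rewrite P0 !subr0; apply => x /andP[x1 x2].
    apply: dP; rewrite (le_lt_trans x2 s0) andbT (lt_le_trans _ x1)//.
    by rewrite ltrN2 ltr_nat.
  exact: sqr_ge0.
have Q_incr s s' : -2 <= s -> s <= s' -> s' < 0 -> Q s <= Q s'.
  move=> s2 ss' s'0.
  have := @le_derive_le _ (fun=> 0) (fun=> 0) Q P s s' ss'.
  rewrite subrr subr_ge0; apply => x /andP[x1 x2].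
    apply: dQ; rewrite (le_lt_trans x2 s'0) andbT.
    by rewrite (lt_le_trans _ (le_trans s2 x1))// ltrN2 ltr_nat.
  by apply: P_ge0; rewrite (le_trans s2 x1) (le_lt_trans x2 s'0).
have cJ x : x < 0 -> {for x, continuous (exp_mean V c)}.
  by move=> x0; exact: (exp_mean_continuous lphV w_ge0 w_cont c0 x0).
have cJw : {within `[-2, s1], continuous (exp_mean V c)}.
  apply: continuous_in_subspaceT => x /[!inE]/= /[!in_itv]/= /andP[_ xs].
  by apply: cJ; exact: le_lt_trans xs s10.
have m21 : -2 <= s1 by clear -s11; lra.
have [s' /[!in_itv]/= /andP[s'2 s's1] s'max] := EVT_max m21 cJw.
set J := exp_mean V c in JK0 cJ cJw s'max *.
have Js1 : J s1 <= J s' by apply: s'max; rewrite in_itv/= m21 lexx.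
apply: (le_trans Js1).
have J10 : J (-1) <= K0 by apply: JK0; rewrite lexx andbT lerN2 ler1n.
have J1ge : 0 <= J (-1) by exact: exp_mean_ge0.
have J2ge : 0 <= J (-2) by exact: exp_mean_ge0.
have Js'ge : 0 <= J s' by exact: exp_mean_ge0.
have [s'1|s'1] := leP s' (-1).
  have : J s' <= K0 by apply: JK0; rewrite s'2.
  by move=> H; apply: (le_trans H); clear -H Js'ge; lra.
set K := J s' in Js'ge *.
have s'0 : s' < 0 by exact: le_lt_trans s's1 s10.
have c20 : 0 <= 8 * c ^+ 2 by rewrite mulr_ge0// sqr_ge0.
pose v s := J s - 8 * c ^+ 2 * K * Q s.
have m12 : -2 < -1 :> R by rewrite ltrN2 ltr1n.
(* concavity of [v], read at the points [-2], [-1] and [s'] *)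
have three : v s' <= v (-1) + (s' - -1) * ((v (-1) - v (-2)) / (-1 - -2)).
  apply: second_difference_concave => //.
    move=> x /andP[x2 xs]; have x0 : x < 0 by exact: le_lt_trans xs s'0.
    apply: cvgB; first exact: cJ.
    apply: cvgM; first exact: cvg_cst.
    apply: (is_derive1_continuous (dQ x _)).
    by rewrite x0 andbT (lt_le_trans _ x2)// ltrN2 ltr_nat.
  move=> s /andP[s2 ss'] e e0; have s0 : s < 0 by exact: lt_trans ss' s'0.
  pose e1 := e / (1 + 8 * c ^+ 2 * K).
  have D0 : 0 < 1 + 8 * c ^+ 2 * K by rewrite ltr_pwDl// mulr_ge0.
  have e10 : 0 < e1 by rewrite divr_gt0.
  have s3 : -3 < s by apply: lt_trans s2; rewrite ltrN2 ltr_nat.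
  have s30 : -3 < s < 0 by rewrite s3.
  have nearQ : \forall x \near s, is_derive x (1:R) Q (P x).
    near=> x; apply: dQ; apply/andP; split; near: x.
      exact: lt_nbhsr.
    exact: lt_nbhsl.
  near=> h.
  have A1 : J (s + h) + J (s - h) - 2 * J s <=
      (8 * c ^+ 2 * w s ^+ 2 * J s + e1) * h ^+ 2.
    by near: h; exact: (exp_mean_second_difference lphV).
  have A2 : (w s ^+ 2 - e1) * h ^+ 2 <= Q (s + h) + Q (s - h) - 2 * Q s.
    by near: h; exact: (second_difference_ge (dP s s30) nearQ).
  have A3 : J s <= K.
    by apply: s'max; rewrite in_itv/= (ltW s2)/= (le_trans (ltW ss')).
  have cK : 0 <= 8 * c ^+ 2 * K by rewrite mulr_ge0.
  have A4 := ler_wpM2l cK A2.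
  have A5 : 8 * c ^+ 2 * w s ^+ 2 * J s <= 8 * c ^+ 2 * w s ^+ 2 * K.
    by apply: ler_wpM2l A3; rewrite mulr_ge0// sqr_ge0.
  have A6 := ler_wpM2r (sqr_ge0 h) A5.
  have e1E : e = e1 * (1 + 8 * c ^+ 2 * K) by rewrite /e1 divfK// gt_eqF.
  rewrite e1E /v.
  have alg (a b d q1 q2 q3 k : R) : a - k * q1 + (b - k * q2) - 2 * (d - k * q3) =
    (a + b - 2 * d) - k * (q1 + q2 - 2 * q3) by ring.
  rewrite alg.
  apply: (le_trans (lerB A1 A4)).
  rewrite -subr_ge0; rewrite -subr_ge0 in A6.
  by apply: (le_trans A6); rewrite le_eqVlt; apply/orP; left; apply/eqP; ring.
have Qs' : Q s' <= Q s1 by exact: Q_incr.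
have Q1 : 0 <= Q (-1) by rewrite -Q0; apply: Q_incr => //; exact: ltW.
have cQ' : 8 * c ^+ 2 * Q s' <= 2^-1.
  by apply: le_trans cQ; exact: ler_wpM2l.
have KQ : 8 * c ^+ 2 * K * Q s' <= K / 2.
  have -> : 8 * c ^+ 2 * K * Q s' = K * (8 * c ^+ 2 * Q s').
    by rewrite mulrAC mulrC.
  exact: ler_wpM2l.
have v1 : v (-1) <= J (-1) by rewrite lerBlDr lerDl mulr_ge0// mulr_ge0.
have v2 : 0 <= v (-2) by rewrite /v Q0 mulr0 subr0.
have -> : K = v s' + 8 * c ^+ 2 * K * Q s' by rewrite /v subrK.
have m1 : -1 - -2 = 1 :> R by ring.
rewrite m1 divr1 opprK in three.
have step : (s' + 1) * (v (-1) - v (-2)) <= J (-1).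
  have a1 : 0 <= s' + 1 by clear -s'1; lra.
  have a2 : s' + 1 <= 1 by clear -s'0; lra.
  have a3 : v (-1) - v (-2) <= J (-1) by clear -v1 v2; lra.
  apply: (le_trans (ler_wpM2l a1 a3)).
  by rewrite ler_piMl.
have Kv : K = v s' + 8 * c ^+ 2 * K * Q s' by rewrite /v subrK.
rewrite -Kv; clear - Kv KQ three step v1 J10; lra.
Unshelve. all: by end_near. Qed.

(** The values on the annulus [e ^ -2 <= |z| <= e ^ -1] only enter through some
    finite bound. *)
Lemma lph_bounded (V : R -> R -> R) (w : R -> R)
    (lphV : log_polar_harmonic V w)
    (w_cont : forall s : R, s < 0 -> {for s, continuous w}) :
  exists2 M, 0 <= M & forall s t, -2 <= s <= -1 -> 0 <= t <= 2 * pi -> V s t <= M.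
Proof.
have m21 : -2 <= -1 :> R by rewrite lerN2 ler1n.
have cw : {within `[-2, -1], continuous w}.
  apply: continuous_in_subspaceT => x /[!inE]/= /[!in_itv]/= /andP[_ xs].
  by apply: w_cont; apply: le_lt_trans xs _; rewrite oppr_lt0.
have [s' _ s'max] := EVT_max m21 cw.
set L := w s' in s'max.
have p0 := twopi_gt0 R.
have m20 : -2 < 0 :> R by rewrite oppr_lt0.
exists (`|V (-2) 0| + `|w (-2)| * (2 * pi) + `|L|).
  by rewrite !addr_ge0// mulr_ge0// ltW.
move=> s t /andP[s2 s1] /andP[t0 t2].
have s0 : s < 0 by apply: le_lt_trans s1 _; rewrite oppr_lt0.
have A1 := lph_angular_osc lphV 0 t m20.
have A2 : `|V s t - V (-2) t| <= `|L| * s - `|L| * (-2).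
  apply: (lph_radial_osc lphV t s2 s0 (fun x _ => is_derive1_linear `|L| x)).
  move=> x /andP[x2 xs]; apply: le_trans (ler_norm _); apply: s'max.
  by rewrite in_itv/= x2 (le_trans xs).
have A3 : `|L| * s - `|L| * (-2) <= `|L|.
  by rewrite -mulrBr ler_piMr//; clear -s1; lra.
have A4 : w (-2) * `|t - 0| <= `|w (-2)| * (2 * pi).
  rewrite subr0 (ger0_norm t0); apply: (le_trans (ler_wpM2r t0 (ler_norm _))).
  exact: ler_wpM2l.
have -> : V s t = V (-2) 0 + (V (-2) t - V (-2) 0) + (V s t - V (-2) t) by ring.
apply: lerD; first apply: lerD; first exact: ler_norm.
  exact: le_trans (ler_norm _) (le_trans A1 A4).
exact: le_trans (ler_norm _) (le_trans A2 A3).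
Qed.

Lemma exp_mean_le (V : R -> R -> R) (w : R -> R)
    (lphV : log_polar_harmonic V w) (c s M : R) :
  0 <= c -> s < 0 -> (forall t, 0 <= t <= 2 * pi -> V s t <= M) ->
  exp_mean V c s <= 2 * pi * expR (c * M).
Proof.
move=> c0 s0 VM.
apply: (le_trans (le_period_integral (g := fun=> expR (c * M)) _ _ _)).
- exact: (exp_cont lphV).
- by move=> t; exact: cvg_cst.
- by move=> t tI; rewrite ler_expR; apply: ler_wpM2l => //; exact: VM.
- rewrite Rintegral_cst//= lebesgue_measure_itv/= lte_fin twopi_gt0/= subr0.
  by rewrite mulrC.
Qed.

End exp_mean_bound.

(** * From exponential means to almost everywhere bounds *)

Section borel_cantelli.
Context {R : realType}.

Local Notation mu := (@lebesgue_measure R).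
Local Notation prob := (uniform_prob (twopi_gt0 R)).
Local Notation Iper := (`[0, 2 * pi]%classic : set R).

Lemma nneseries_inv_sqr_lty (C : R) : 0 <= C ->
  (\sum_(k <oo) (C / k.+1%:R ^+ 2)%:E < +oo)%E.
Proof.
move=> C0.
have le1 n : C / n.+1%:R ^+ 2 <= 2 * C * (n.+1%:R^-1 - n.+2%:R^-1).
  have -> : 2 * C * (n.+1%:R^-1 - n.+2%:R^-1) = C * (2 / (n.+1%:R * n.+2%:R)).
    rewrite -[n.+2%:R]natr1; have : 0 < n.+1%:R :> R by [].
    by move: n.+1%:R => a a0; field; apply/andP; split; rewrite gt_eqF//; lra.
  apply: ler_wpM2l => //; rewrite -[n.+2%:R]natr1.
  have : 1 <= n.+1%:R :> R by rewrite ler1n.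
  move: n.+1%:R => a a1; have a0 : 0 < a by exact: lt_le_trans a1.
  rewrite ler_pdivlMr; last by rewrite mulr_gt0// addr_gt0.
  by rewrite mulrC ler_pdivrMr ?exprn_gt0//; nra.
apply: (@le_lt_trans _ _ (2 * C)%:E); last exact: ltry.
apply: lime_le.
  by apply: is_cvg_nneseries => k _ _; rewrite lee_fin divr_ge0// sqr_ge0.
apply: nearW => n; rewrite sumEFin lee_fin.
apply: (@le_trans _ _ (\sum_(0 <= k < n) 2 * C * (k.+1%:R^-1 - k.+2%:R^-1))).
  by apply: ler_sum => k _; exact: le1.
rewrite -mulr_sumr ler_piMr ?mulr_ge0//.
rewrite -[leLHS]opprK -sumrN.
under eq_bigr do rewrite opprB.
rewrite (telescope_sumr (fun k => k.+1%:R^-1 : R))// invr1 opprB.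
by rewrite gerBl invr_ge0.
Qed.

Lemma exp_mean_borel_cantelli (V : R -> R -> R) (w : R -> R)
    (lphV : log_polar_harmonic V w) (c s : nat -> R) (C : R) :
  (forall k, 0 < c k) -> (forall k, s k < 0) ->
  (forall k, exp_mean V (c k) (s k) <= C) ->
  {ae prob, forall t, \forall k \near \oo, V (s k) t <= 2 * ln k.+1%:R / c k}.
Proof.
move=> c0 s0 JC.
pose E k : set R := [set t | 2 * ln k.+1%:R / c k < V (s k) t].
have mV k : measurable_fun setT (V (s k)).
  by apply: continuous_measurable_fun; exact: (lph_continuous_angle lphV).
have mE k : measurable (E k).
  have -> : E k = V (s k) @^-1` `]2 * ln k.+1%:R / c k, +oo[%classic.
    by apply/seteqP; split => t; rewrite /E /= in_itv/= andbT.
  by rewrite -[X in measurable X]setTI; exact: mV.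
have C0 : 0 <= C by apply: le_trans (JC 0%N); exact: exp_mean_ge0.
have ce k : continuous (fun t => expR (c k * V (s k) t)) by exact: (exp_cont lphV).
have cef k : measurable_fun setT (EFin \o (fun t => expR (c k * V (s k) t))).

  by apply/measurable_EFinP; apply: continuous_measurable_fun; exact: ce.
(* Markov's inequality at the level [e ^ (2 ln (k + 1))] *)
have PE k : (prob (E k) <= ((2 * pi)^-1 * C / k.+1%:R ^+ 2)%:E)%E.
  have k0 : 0 < k.+1%:R ^+ 2 :> R by rewrite exprn_gt0.
  have -> : prob (E k) = (\int[prob]_t (\1_(E k) t)%:E)%E.
    by rewrite integral_indic//=; [rewrite setIT|exact: mE].
  apply: (@le_trans _ _ (\int[prob]_t
      ((k.+1%:R ^+ 2)^-1%:E * (expR (c k * V (s k) t))%:E)))%E.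
    apply: ge0_le_integral => //.
    - by apply/measurable_EFinP; apply: measurable_indic; exact: mE.
    - by apply: measurable_funeM; exact: cef.
    - move=> t _; rewrite -EFinM lee_fin indicE.
      have [/set_mem tE|_] := boolP (t \in E k); last first.
        by rewrite mulr_ge0// ?invr_ge0 ?expR_ge0// ltW.
      rewrite /= mulrC ler_pdivlMr// mul1r.
      have -> : k.+1%:R ^+ 2 = expR (2 * ln k.+1%:R) :> R.
        by rewrite expRM_natl lnK// posrE.
      rewrite ler_expR [leRHS]mulrC -ler_pdivrMr//; exact: ltW.
  rewrite ge0_integralZl//; last exact: cef.
  rewrite integral_uniform//; last exact: cef.
  have -> : (\int[mu]_(x in Iper) (expR (c k * V (s k) x))%:E =
      (exp_mean V (c k) (s k))%:E)%E.
    rewrite /exp_mean /Rintegral fineK//.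
    by apply: integrable_fin_num => //; exact: period_integrable.
  rewrite subr0 -!EFinM lee_fin mulrC; apply: ler_wpM2r.
    by rewrite invr_ge0 ltW.
  by apply: ler_wpM2l; [rewrite invr_ge0 ltW// twopi_gt0|exact: JC].
have sum_lt : (\sum_(k <oo) prob (E k) < +oo)%E.
  apply: le_lt_trans (@nneseries_inv_sqr_lty ((2 * pi)^-1 * C) _).
    by apply: lee_nneseries => // k _; rewrite measure_ge0.
  by rewrite mulr_ge0// invr_ge0 ltW// twopi_gt0.
have null : prob (lim_sup_set E) = 0%E by apply: lim_sup_set_cvg0.
exists (lim_sup_set E); split => //.
  by apply: bigcap_measurable => // k _; apply: bigcup_measurable => j _; exact: mE.
move=> t /= nt n _.
apply: contrapT => H; apply: nt; exists n => // k /= nk.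
rewrite leNgt; apply/negP => tE; apply: H.
by exists k.
Qed.

End borel_cantelli.

(** * Local estimates for analytic functions *)

(* keeps [normc 0] and the like from unfolding to square roots *)
Local Arguments ComplexField.Normc.normc _ _ : simpl never.

Section modulus.
Context {R : realType}.
Implicit Types (x y z : R[i]).

Lemma normc_normE z : `|z| = (normc z)%:C.
Proof. by case: z. Qed.

Lemma normcD_le x y : normc (x + y) <= normc x + normc y.
Proof. exact: le_normcD. Qed.

Lemma normc_opp z : normc (- z) = normc z.
Proof. exact: normcN. Qed.

Lemma normc_mul x y : normc (x * y) = normc x * normc y.
Proof. exact: ComplexField.Normc.normcM. Qed.

Lemma normc_nneg z : 0 <= normc z.
Proof. by case: z => a b; exact: sqrtr_ge0. Qed.

Lemma normc_zero : normc (0 : R[i]) = 0.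
Proof. exact: ComplexField.Normc.normc0. Qed.

Lemma normc_one : normc (1 : R[i]) = 1.
Proof. exact: ComplexField.Normc.normc1. Qed.

Lemma normc_exp z n : normc (z ^+ n) = normc z ^+ n.
Proof. by elim: n => [|n IH]; rewrite ?expr0 ?normc_one// !exprS normc_mul IH. Qed.

Lemma normc_real (a : R) : normc a%:C = `|a|.
Proof. by rewrite /normc/= expr0n/= addr0 sqrtr_sqr. Qed.

Lemma normc_le_abs (a b : R) : normc (a +i* b) <= `|a| + `|b|.
Proof.
rewrite -[leRHS]ger0_norm ?addr_ge0// -sqrtr_sqr ler_sqrt ?sqr_ge0//.
rewrite -(real_normK (num_real a)) -(real_normK (num_real b)) sqrrD -addrA.
by rewrite lerD2l lerDr mulrn_wge0// mulr_ge0.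
Qed.

Lemma normc_sum (F : nat -> R[i]) n :
  normc (\sum_(0 <= k < n) F k) <= \sum_(0 <= k < n) normc (F k).
Proof.
elim: n => [|n IH]; first by rewrite !big_geq// normc_zero.
by rewrite !big_nat_recr//=; apply: (le_trans (normcD_le _ _)); rewrite lerD2r.
Qed.

Lemma abs_Re_le z : `|complex.Re z| <= normc z.
Proof.
case: z => a b; rewrite /normc/= -sqrtr_sqr ler_sqrt ?addr_ge0 ?sqr_ge0//.
by rewrite lerDl sqr_ge0.
Qed.

Lemma abs_Im_le z : `|complex.Im z| <= normc z.
Proof.
case: z => a b; rewrite /normc/= -sqrtr_sqr ler_sqrt ?addr_ge0 ?sqr_ge0//.
by rewrite lerDr sqr_ge0.
Qed.

Lemma cvg_normc_lt (u : nat -> R[i]^o) (l : R[i]^o) (e : R) :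
  u @ \oo --> l -> 0 < e -> \forall n \near \oo, normc (l - u n) < e.
Proof.
move=> ul e0; have eC : 0 < e%:C :> R[i] by rewrite ltcR.
move/cvgrPdist_lt : ul => /(_ _ eC); apply: filterS => n.
by rewrite normc_normE ltcR.
Qed.

Lemma cvg_normc_le (u : nat -> R[i]^o) (l : R[i]^o) (B : R) :
  u @ \oo --> l -> (\forall n \near \oo, normc (u n) <= B) -> normc l <= B.
Proof.
move=> ul uB; apply/ler_addgt0Pr => e e0.
have ul' := cvg_normc_lt ul e0.
near \oo => n.
have -> : l = u n + (l - u n) by rewrite addrC subrK.
apply: (le_trans (normcD_le _ _)); apply: lerD; first by near: n.
by apply: ltW; near: n.
Unshelve. all: by end_near. Qed.

End modulus.

Section power_expansion.
Context {R : realType}.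
Implicit Types (u k : R[i]) (r : R).

(** The coefficients of [k] and [k ^ 2] in [(u + k) ^ n]. *)
Fixpoint pow_coef1 u n : R[i] :=
  if n is m.+1 then u * pow_coef1 u m + u ^+ m else 0.

Fixpoint pow_coef2 u n : R[i] :=
  if n is m.+1 then u * pow_coef2 u m + pow_coef1 u m else 0.

(** The three bounds below carry the factor [r ^ j], instead of a power
    [r ^ (n - j)] on the right-hand side, so that they hold for all [n]. *)
Lemma pow_coef1_le u r n : 0 <= r -> normc u <= r ->
  normc (pow_coef1 u n) * r <= n%:R * r ^+ n.
Proof.
move=> r0 ur; elim: n => [|n IH] /=; first by rewrite normc_zero mul0r expr0 mulr1.
apply: (le_trans (ler_wpM2r r0 (normcD_le _ _))).
rewrite normc_mul normc_exp mulrDl -natr1 mulrDl mul1r exprSr; apply: lerD.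
  have -> : n%:R * (r ^+ n * r) = r * (n%:R * r ^+ n) by ring.
  by rewrite -mulrA; apply: ler_pM => //; rewrite ?mulr_ge0 ?normc_nneg.
by apply: ler_wpM2r => //; rewrite lerXn2r// ?nnegrE ?normc_nneg.
Qed.

Lemma pow_coef2_le u r n : 0 <= r -> normc u <= r ->
  normc (pow_coef2 u n) * r ^+ 2 <= n%:R ^+ 2 * r ^+ n.
Proof.
move=> r0 ur; elim: n => [|n IH] /=.
  by rewrite normc_zero mul0r expr0n/= mul0r.
have D1 := pow_coef1_le n r0 ur.
apply: (le_trans (ler_wpM2r (sqr_ge0 r) (normcD_le _ _))).
rewrite normc_mul mulrDl.
apply: (@le_trans _ _ (r * (n%:R ^+ 2 * r ^+ n) + r * (n%:R * r ^+ n))).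
  apply: lerD.
    by rewrite -mulrA; apply: ler_pM => //; rewrite ?mulr_ge0 ?normc_nneg ?sqr_ge0.
  have -> : normc (pow_coef1 u n) * r ^+ 2 = r * (normc (pow_coef1 u n) * r) by ring.
  exact: ler_wpM2l.
rewrite -mulrDr -mulrDl mulrCA -exprS; apply: ler_wpM2r; first exact: exprn_ge0.
by rewrite -natr1; have : 0 <= n%:R :> R by []; move: n%:R => a a0; nra.
Qed.

Lemma pow_expansion_le u k r n : 0 <= r -> normc u <= r -> normc (u + k) <= r ->
  normc ((u + k) ^+ n - (u ^+ n + pow_coef1 u n * k + pow_coef2 u n * k ^+ 2))
    * r ^+ 3 <= n%:R ^+ 3 * r ^+ n * normc k ^+ 3.
Proof.
move=> r0 ur ukr; elim: n => [|n IH] /=.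
  by rewrite !expr0 !mul0r !addr0 subrr normc_zero mul0r expr0n/= !mul0r.
have D2 := pow_coef2_le n r0 ur.
set D := (u + k) ^+ n - _ in IH.
have -> : (u + k) ^+ n.+1 - (u ^+ n.+1 + (u * pow_coef1 u n + u ^+ n) * k +
    (u * pow_coef2 u n + pow_coef1 u n) * k ^+ 2) =
    (u + k) * D + pow_coef2 u n * k ^+ 3.
  by rewrite /D !exprS; ring.
have r3 : 0 <= r ^+ 3 by exact: exprn_ge0.
apply: (le_trans (ler_wpM2r r3 (normcD_le _ _))).
rewrite (normc_mul (u + k)) (normc_mul (pow_coef2 u n)) normc_exp mulrDl.
apply: (@le_trans _ _ (r * (n%:R ^+ 3 * r ^+ n * normc k ^+ 3) +
    (n%:R ^+ 2 * r ^+ n) * (r * normc k ^+ 3))).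
  apply: lerD.
    have -> : normc (u + k) * normc D * r ^+ 3 = normc (u + k) * (normc D * r ^+ 3).
      by rewrite mulrA.
    apply: ler_pM; [exact: normc_nneg| |exact: ukr|exact: IH].
    exact: mulr_ge0 (normc_nneg _) r3.
  have -> : normc (pow_coef2 u n) * normc k ^+ 3 * r ^+ 3 =
    (normc (pow_coef2 u n) * r ^+ 2) * (r * normc k ^+ 3) by ring.
  by apply: ler_wpM2r => //; rewrite mulr_ge0 ?exprn_ge0 ?normc_nneg.
have -> : r * (n%:R ^+ 3 * r ^+ n * normc k ^+ 3) +
    n%:R ^+ 2 * r ^+ n * (r * normc k ^+ 3) =
    (n%:R ^+ 3 + n%:R ^+ 2) * (r ^+ n.+1 * normc k ^+ 3).
  by rewrite (exprS r n); ring.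
rewrite -mulrA; apply: ler_wpM2r; first by rewrite mulr_ge0 ?exprn_ge0 ?normc_nneg.
by rewrite -natr1; have : 0 <= n%:R :> R by []; move: n%:R => a a0; nra.
Qed.

(** The size of a quadruple of increments that matters for the mean value
    property. It vanishes up to [O(h ^ 3)] on the vertices [h], [- h], [i h], [- i h]
    of a square centered at the origin. *)
Definition quad_defect (k1 k2 k3 k4 : R[i]) : R :=
  normc (k1 + k2 + k3 + k4) +
  normc (k1 ^+ 2 + k2 ^+ 2 + k3 ^+ 2 + k4 ^+ 2) +
  (normc k1 ^+ 3 + normc k2 ^+ 3 + normc k3 ^+ 3 + normc k4 ^+ 3).

Lemma quad_defect_ge0 k1 k2 k3 k4 : 0 <= quad_defect k1 k2 k3 k4.
Proof. by rewrite !addr_ge0// ?exprn_ge0// normc_nneg. Qed.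

Lemma pow_four_points u r n k1 k2 k3 k4 : 0 <= r <= 1 -> normc u <= r ->
  normc (u + k1) <= r -> normc (u + k2) <= r ->
  normc (u + k3) <= r -> normc (u + k4) <= r ->
  normc (((u + k1) ^+ n - u ^+ n) + ((u + k2) ^+ n - u ^+ n) +
    ((u + k3) ^+ n - u ^+ n) + ((u + k4) ^+ n - u ^+ n)) * r ^+ 3 <=
  n%:R ^+ 3 * r ^+ n * quad_defect k1 k2 k3 k4.
Proof.
move=> /andP[r0 r1] ur uk1 uk2 uk3 uk4.
have H1 := pow_expansion_le n r0 ur uk1; have H2 := pow_expansion_le n r0 ur uk2.
have H3 := pow_expansion_le n r0 ur uk3; have H4 := pow_expansion_le n r0 ur uk4.
have D1 := pow_coef1_le n r0 ur; have D2 := pow_coef2_le n r0 ur.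
move: H1 H2 H3 H4 D1 D2.
move: (pow_coef1 u n) (pow_coef2 u n) => c1 c2.
set U1 := (u + k1) ^+ n; set U2 := (u + k2) ^+ n.
set U3 := (u + k3) ^+ n; set U4 := (u + k4) ^+ n; set U := u ^+ n.
set E1 := U1 - _; set E2 := U2 - _; set E3 := U3 - _; set E4 := U4 - _.
move=> H1 H2 H3 H4 D1 D2.
have -> : U1 - U + (U2 - U) + (U3 - U) + (U4 - U) =
  c1 * (k1 + k2 + k3 + k4) + c2 * (k1 ^+ 2 + k2 ^+ 2 + k3 ^+ 2 + k4 ^+ 2) +
  (E1 + E2 + E3 + E4).
  by rewrite /E1 /E2 /E3 /E4; ring.
have r3 : 0 <= r ^+ 3 by exact: exprn_ge0.
have rn : 0 <= r ^+ n by exact: exprn_ge0.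
have n3 : n%:R <= n%:R ^+ 3 :> R.
  rewrite -natrX ler_nat -[X in (X <= _)%N]expn1.
  by case: (n) => // m; exact: leq_pexp2l.
have n32 : n%:R ^+ 2 <= n%:R ^+ 3 :> R.
  by rewrite -!natrX ler_nat; case: (n) => // m; exact: leq_pexp2l.
apply: (le_trans (ler_wpM2r r3 (normcD_le _ _))).
apply: (le_trans (ler_wpM2r r3 (lerD (normcD_le _ _) (normcD_le _ _)))).
apply: (le_trans (ler_wpM2r r3 (lerD (lexx _) (lerD (normcD_le _ _) (lexx _))))).
apply: (le_trans (ler_wpM2r r3 (lerD (lexx _)
  (lerD (lerD (normcD_le _ _) (lexx _)) (lexx _))))).
rewrite (normc_mul c1) (normc_mul c2) !mulrDl !mulrDr; apply: lerD; last first.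
  by rewrite !lerD.
apply: lerD.
  have -> : normc c1 * normc (k1 + k2 + k3 + k4) * r ^+ 3 =
    ((normc c1 * r) * r ^+ 2) * normc (k1 + k2 + k3 + k4) by ring.
  apply: ler_wpM2r; first exact: normc_nneg.
  rewrite -[leRHS]mulr1; apply: ler_pM; rewrite ?mulr_ge0 ?normc_nneg ?exprn_ge0//.
    by apply: (le_trans D1); apply: ler_wpM2r.
  exact: exprn_ile1.
set q := normc (k1 ^+ 2 + k2 ^+ 2 + k3 ^+ 2 + k4 ^+ 2).
have -> : normc c2 * q * r ^+ 3 = ((normc c2 * r ^+ 2) * r) * q by ring.
apply: ler_wpM2r; first exact: normc_nneg.
rewrite -[leRHS]mulr1; apply: ler_pM; rewrite ?mulr_ge0 ?normc_nneg ?exprn_ge0//.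
by apply: (le_trans D2); apply: ler_wpM2r.
Qed.

End power_expansion.

Section local_expansion.
Context {R : realType}.

Lemma cube_le_exp8 n : (n ^ 3 <= 8 ^ n)%N.
Proof.
have n2 : (n <= 2 ^ n)%N by exact: ltnW (ltn_expl _ _).
by rewrite -[8%N]/(2 ^ 3)%N -expnM mulnC expnM leq_exp2r.
Qed.

Lemma geometric_half_le n : \sum_(0 <= k < n) (2^-1 : R) ^+ k <= 2.
Proof.
suff -> : \sum_(0 <= k < n) (2^-1 : R) ^+ k = 2 - 2 * 2^-1 ^+ n.
  by rewrite gerBl mulr_ge0// exprn_ge0.
elim: n => [|n IH]; first by rewrite big_geq// expr0; lra.
by rewrite big_nat_recr//= IH exprS; lra.
Qed.

Lemma power_series_terms_bounded (a : nat -> R[i]) (x : R[i]) (l : R[i]^o) :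
  series (fun n => a n * x ^+ n : R[i]^o) @ \oo --> l ->
  exists2 M, 0 <= M & forall n, normc (a n) * normc x ^+ n <= M.
Proof.
move=> cl.
have c0 : (fun n => a n * x ^+ n : R[i]^o) @ \oo --> (0 : R[i]^o).
  by apply: cvg_series_cvg_0; apply/cvg_ex; exists l.
have [N _ HN] := cvg_normc_lt c0 ltr01.
exists (1 + \sum_(0 <= k < N) normc (a k) * normc x ^+ k).
  by rewrite addr_ge0// sumr_ge0// => k _; rewrite mulr_ge0 ?exprn_ge0 ?normc_nneg.
move=> n; have [nN|Nn] := ltnP n N.
  rewrite (big_cat_nat (n := n))//=; last exact: ltnW.
  rewrite [X in _ + (_ + X)]big_ltn//.
  rewrite addrCA; apply: le_trans (_ : normc (a n) * normc x ^+ n + 0 <= _).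
    by rewrite addr0.
  rewrite [leRHS](_ : _ = normc (a n) * normc x ^+ n +
    (1 + (\sum_(0 <= i < n) normc (a i) * normc x ^+ i +
      \sum_(n.+1 <= i < N) normc (a i) * normc x ^+ i))); last by ring.
  rewrite lerD2l !addr_ge0// sumr_ge0// => k _;
    by rewrite mulr_ge0 ?exprn_ge0 ?normc_nneg.
have := HN n Nn; rewrite /= sub0r normc_opp normc_mul normc_exp.
move=> /ltW /le_trans; apply.
by rewrite lerDl sumr_ge0// => k _; rewrite mulr_ge0 ?exprn_ge0 ?normc_nneg.
Qed.

Lemma pow_coef1_0 n : pow_coef1 (0 : R[i]) n = (n == 1%N)%:R.
Proof.
by case: n => [|n]//=; rewrite mul0r add0r expr0n eqSS; case: n.
Qed.

Lemma pow_tangent_le (k : R[i]) r n : 0 < r -> normc k <= r ->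
  normc (k ^+ n - 0 ^+ n - (n == 1%N)%:R * k) * r ^+ 2 <=
  2 * (n%:R ^+ 3 * r ^+ n) * normc k ^+ 2.
Proof.
move=> r0 kr.
have z0 : normc (0 : R[i]) <= r by rewrite normc_zero ltW.
have zk : normc (0 + k) <= r by rewrite add0r.
have H := pow_expansion_le n (ltW r0) z0 zk.
have H2 := pow_coef2_le n (ltW r0) z0.
rewrite add0r pow_coef1_0 in H.
move: H H2; move: (pow_coef2 0 n) => c2; set E := k ^+ n - (_ + _) => H H2.
have -> : k ^+ n - 0 ^+ n - (n == 1%N)%:R * k = E + c2 * k ^+ 2.
  by rewrite /E; ring.
have k2 : 0 <= normc k ^+ 2 by exact: sqr_ge0.
have n0 : 0 <= n%:R ^+ 3 * r ^+ n.
  by rewrite mulr_ge0// exprn_ge0// ltW.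
apply: (le_trans (ler_wpM2r (sqr_ge0 r) (normcD_le _ _))).
rewrite (normc_mul c2) (normc_exp k) mulrDl.
set A := n%:R ^+ 3 * r ^+ n in n0 H *.
have -> : 2 * A * normc k ^+ 2 = A * normc k ^+ 2 + A * normc k ^+ 2 by ring.
apply: lerD.
  rewrite -(ler_pM2r r0); have -> : normc E * r ^+ 2 * r = normc E * r ^+ 3 by ring.
  apply: (le_trans H).
  have -> : A * normc k ^+ 3 = A * normc k ^+ 2 * normc k by ring.
  by apply: ler_wpM2l => //; exact: mulr_ge0.
rewrite mulrAC; apply: ler_wpM2r => //.
apply: (le_trans H2); apply: ler_wpM2r; first by rewrite exprn_ge0// ltW.
by rewrite -!natrX ler_nat; case: (n) => // m; exact: leq_pexp2l.
Qed.

(** Two consequences of a local power series at [z0]: the expansion of [f] to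
    first order at [z0], and a mean value property for quadruples of increments
    at all points near [z0], with the same constant. *)
Lemma analytic_local_estimates (U : set R[i]) (f : R[i] -> R[i]^o) (z0 : R[i]) :
  analytic_on U f -> U z0 ->
  exists (a1 : R[i]) (r K : R), [/\ 0 < r, 0 <= K,
   (forall k, normc k <= r ->
     normc (f (z0 + k) - f z0 - a1 * k) <= K * normc k ^+ 2) &
   (forall z k1 k2 k3 k4, normc (z - z0) <= r ->
     normc k1 <= r -> normc k2 <= r -> normc k3 <= r -> normc k4 <= r ->
     normc ((f (z + k1) - f z) + (f (z + k2) - f z) +
       (f (z + k3) - f z) + (f (z + k4) - f z)) <=
     K * quad_defect k1 k2 k3 k4)].
Proof.
move=> af Uz0; have [a [e [e0 fser]]] := af _ Uz0.
pose e1 := Num.min e 1 / 2.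
have m0 : 0 < Num.min e 1 by rewrite lt_min e0 ltr01.
have e10 : 0 < e1 by rewrite divr_gt0.
have e1e : e1 < e.
  have : Num.min e 1 <= e by rewrite ge_min lexx.
  by rewrite /e1; move: m0; clear; move: (Num.min e 1) => m; lra.
have e1le : e1 <= 1.
  have : Num.min e 1 <= 1 by rewrite ge_min lexx orbT.
  by rewrite /e1; move: m0; clear; move: (Num.min e 1) => m; lra.
have [M M0 aM] : exists2 M, 0 <= M & forall n, normc (a n) * e1 ^+ n <= M.
  have ne1 : normc e1%:C = e1 by rewrite normc_real gtr0_norm.
  have := fser (z0 + e1%:C); rewrite addrC addKr ne1 => /(_ e1e).
  by move=> /power_series_terms_bounded; rewrite ne1.
(* [n ^ 3 (e1 / 16) ^ n <= (e1 / 2) ^ n] makes the error series summable *)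
pose p := e1 / 16.
have p0 : 0 < p by rewrite divr_gt0.
have pe1 : p <= e1 by rewrite /p; move: e10; clear; lra.
have p1 : p <= 1 by exact: le_trans e1le.
have coef_sum N : \sum_(0 <= n < N) normc (a n) * (n%:R ^+ 3 * p ^+ n) <= 2 * M.
  apply: (@le_trans _ _ (\sum_(0 <= n < N) M * 2^-1 ^+ n)).
    apply: ler_sum => n _; rewrite /p expr_div_n.
    have -> : normc (a n) * (n%:R ^+ 3 * (e1 ^+ n / 16 ^+ n)) =
      (normc (a n) * e1 ^+ n) * (n%:R ^+ 3 / 16 ^+ n).
      by ring.
    apply: ler_pM => //.
      by rewrite mulr_ge0 ?normc_nneg ?exprn_ge0// ltW.
    rewrite ler_pdivrMr ?exprn_gt0// -exprMn.
    have -> : 2^-1 * 16 = 8 :> R by lra.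
    by rewrite -!natrX ler_nat cube_le_exp8.
  rewrite -mulr_sumr mulrC; apply: ler_wpM2r => //; exact: geometric_half_le.
pose S N (v : R[i]) : R[i]^o := series (fun n => a n * v ^+ n : R[i]^o) N.
have Scvg v : normc v <= p -> S ^~ v @ \oo --> f (z0 + v).
  move=> vp; have := fser (z0 + v); rewrite [z0 + v]addrC addrK; apply.
  exact: le_lt_trans vp (le_lt_trans pe1 e1e).
exists (a 1%N), (p / 2), (4 * M / p ^+ 2 + 2 * M / p ^+ 3); split.
- by rewrite divr_gt0.
- by rewrite addr_ge0// divr_ge0 ?mulr_ge0 ?exprn_ge0// ltW.
- move=> k kr; have kp : normc k <= p by apply: (le_trans kr); move: p0; clear; lra.
  have z0p : normc (0 : R[i]) <= p by rewrite normc_zero ltW.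
  pose T N : R[i]^o := S N k - S N 0 - a 1%N * k.
  have cT : T @ \oo --> (f (z0 + k) - f z0 - a 1%N * k : R[i]^o).
    apply: cvgB; last exact: cvg_cst.
    apply: cvgB; first exact: Scvg.
    by rewrite -[in f z0](addr0 z0); exact: Scvg.
  have TE N : (1 < N)%N -> T N =
      \sum_(0 <= n < N) a n * (k ^+ n - 0 ^+ n - (n == 1%N)%:R * k).
    move=> N1; rewrite /T /S /series/=.
    under [RHS]eq_bigr do rewrite !mulrBr.
    rewrite !sumrB; congr (_ - _).
    rewrite big_ltn; last exact: ltnW.
    rewrite big_ltn//= mul0r mulr0 add0r mul1r big_nat_cond big1 ?addr0//.
    by move=> n /andP[/andP[n1 _] _]; rewrite gtn_eqF// mul0r mulr0.
  have p2 : 0 < p ^+ 2 by rewrite exprn_gt0.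
  apply: (@le_trans _ _ (4 * M / p ^+ 2 * normc k ^+ 2)); last first.
    apply: ler_wpM2r; first exact: sqr_ge0.
    by rewrite lerDl divr_ge0 ?mulr_ge0 ?exprn_ge0// ltW.
  apply: (cvg_normc_le cT); exists 2 => // N /= N2; rewrite TE//.
  rewrite mulrAC ler_pdivlMr//; apply: (le_trans (ler_wpM2r (ltW p2) (normc_sum _ _))).
  rewrite mulr_suml.
  apply: (@le_trans _ _ (\sum_(0 <= n < N)
      (2 * normc k ^+ 2) * (normc (a n) * (n%:R ^+ 3 * p ^+ n)))).
    apply: ler_sum => n _.
    have -> : 2 * normc k ^+ 2 * (normc (a n) * (n%:R ^+ 3 * p ^+ n)) =
      normc (a n) * (2 * (n%:R ^+ 3 * p ^+ n) * normc k ^+ 2) by ring.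
    rewrite normc_mul -[leLHS]mulrA; apply: ler_wpM2l; first exact: normc_nneg.
    exact: pow_tangent_le.
  rewrite -mulr_sumr.
  have -> : 4 * M * normc k ^+ 2 = 2 * normc k ^+ 2 * (2 * M) by ring.
  by apply: ler_wpM2l => //; rewrite mulr_ge0// sqr_ge0.
- move=> z k1 k2 k3 k4 zr k1r k2r k3r k4r.
  pose u := z - z0.
  have up : normc u <= p by apply: (le_trans zr); move: p0; clear; lra.
  have ukp k : normc k <= p / 2 -> normc (u + k) <= p.
    move=> kr; apply: (le_trans (normcD_le _ _)).
    by move: (normc u) (normc k) zr kr => x y; clear; lra.
  have zE k : z + k = z0 + (u + k) by rewrite /u; ring.
  have zE0 : z = z0 + u by rewrite /u; ring.
  pose T N : R[i]^o := (S N (u + k1) - S N u) + (S N (u + k2) - S N u) +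
    (S N (u + k3) - S N u) + (S N (u + k4) - S N u).
  have cT : T @ \oo --> ((f (z + k1) - f z) + (f (z + k2) - f z) +
       (f (z + k3) - f z) + (f (z + k4) - f z) : R[i]^o).
    have c k : normc k <= p / 2 ->
        (fun N => S N (u + k) - S N u) @ \oo --> (f (z + k) - f z : R[i]^o).
      move=> kr; rewrite zE; have -> : f z = f (z0 + u) by rewrite -zE0.
      by apply: cvgB; [exact: Scvg (ukp _ kr)|exact: Scvg].
    by apply: cvgD; [apply: cvgD; [apply: cvgD|]|]; exact: c.
  have TE N : T N = \sum_(0 <= n < N) a n * (((u + k1) ^+ n - u ^+ n) +
      ((u + k2) ^+ n - u ^+ n) + ((u + k3) ^+ n - u ^+ n) +
      ((u + k4) ^+ n - u ^+ n)).
    rewrite /T /S /series/=; under [RHS]eq_bigr do rewrite !mulrDr !mulrN.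
    by rewrite !big_split/= !sumrN.
  have p3 : 0 < p ^+ 3 by rewrite exprn_gt0.
  have Q0 := quad_defect_ge0 k1 k2 k3 k4.
  apply: (@le_trans _ _ (2 * M / p ^+ 3 * quad_defect k1 k2 k3 k4)); last first.
    apply: ler_wpM2r => //.
    by rewrite lerDr divr_ge0 ?mulr_ge0 ?exprn_ge0// ltW.
  apply: (cvg_normc_le cT); apply: nearW => N; rewrite TE.
  rewrite mulrAC ler_pdivlMr//; apply: (le_trans (ler_wpM2r (ltW p3) (normc_sum _ _))).
  rewrite mulr_suml.
  apply: (@le_trans _ _ (\sum_(0 <= n < N)
      (normc (a n) * (n%:R ^+ 3 * p ^+ n)) * quad_defect k1 k2 k3 k4)).
    apply: ler_sum => n _.
    rewrite normc_mul -[leLHS]mulrA -[leRHS]mulrA.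
    apply: ler_wpM2l; first exact: normc_nneg.
    by apply: pow_four_points; rewrite ?ukp// ltW//=.
  by rewrite -mulr_suml; exact: ler_wpM2r.
Qed.

End local_expansion.

(** * Analytic functions in logarithmic polar coordinates *)

Section log_polar.
Context {R : realType}.
Implicit Types (z k : R[i]) (s t h : R).

Lemma derive1_eq_of_expansion (f : R[i] -> R[i]^o) z (a : R[i]) (r K : R) :
  0 < r -> 0 <= K ->
  (forall k, normc k <= r -> normc (f (z + k) - f z - a * k) <= K * normc k ^+ 2) ->
  derive1 f z = a.
Proof.
move=> r0 K0 fa; apply: cvg_lim => //.
apply/cvgrPdist_le => /= e e0.
have [e1 e10 eE] : exists2 e1 : R, 0 < e1 & e = e1%:C.
  move: e0; case: e => x y; rewrite ltcE/= => /andP[/eqP y0 x0].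
  by exists x => //; rewrite y0.
have d0 : 0 < (Num.min r (e1 / (K + 1)))%:C :> R[i].
  by rewrite ltcR lt_min r0 divr_gt0// ltr_wpDl.
near=> h.
have h0 : h != 0.
  by near: h; exact: (@nbhs_dnbhs_neq ((R[i])^o : topologicalType)).
have : `|h| < (Num.min r (e1 / (K + 1)))%:C.
  by near: h; exact: (@dnbhs0_lt _ ((R[i])^o : normedModType R[i])).
rewrite normc_normE ltcR lt_min => /andP[hr he].
have nh0 : 0 < normc h.
  rewrite lt_neqAle normc_nneg andbT eq_sym.
  by apply/eqP => /ComplexField.Normc.eq0_normc; apply/eqP.
rewrite eE normc_normE lecR.
have -> : a - h^-1 *: (f (h + z) - f z) = - (h^-1 * (f (z + h) - f z - a * h)).
  rewrite [h + z]addrC mulrBr [h^-1 * (a * h)]mulrCA mulVf// mulr1 opprB.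
  by [].
rewrite normc_opp normc_mul ComplexField.Normc.normcV mulrC ler_pdivrMr//.
apply: (le_trans (fa _ (ltW hr))); rewrite expr2 mulrA.
apply: ler_wpM2r; first exact: ltW.
apply: (@le_trans _ _ ((K + 1) * normc h)).
  by apply: ler_wpM2r; rewrite ?lerDl// ltW.
by rewrite mulrC -ler_pdivlMr ?ltr_wpDl//; exact: ltW.
Unshelve. all: by end_near. Qed.

(** Real linear functionals of norm at most 1, such as the real and imaginary
    parts. *)
Definition contractive_functional (L : R[i] -> R) : Prop :=
  [/\ forall x y, L (x + y) = L x + L y,
      forall (p : R) x, L (p%:C * x) = p * L x &
      forall x, `|L x| <= normc x].

Lemma contractive_Re : contractive_functional (@complex.Re R).
Proof.
split=> [[a b] [c d]//|p [a b]|x]; last exact: abs_Re_le.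
by rewrite /= mul0r subr0.
Qed.

Lemma contractive_Im : contractive_functional (@complex.Im R).
Proof.
split=> [[a b] [c d]//|p [a b]|x]; last exact: abs_Im_le.
by rewrite /= mul0r addr0.
Qed.

Lemma contractiveN L x : contractive_functional L -> L (- x) = - L x.
Proof.
move=> [_ LZ _]; have -> : - x = (-1)%:C * x by rewrite rmorphN1 mulN1r.
by rewrite LZ mulN1r.
Qed.

Lemma contractiveB L x y : contractive_functional L -> L (x - y) = L x - L y.
Proof. by move=> cL; have [LD _ _] := cL; rewrite LD contractiveN. Qed.

(** Chain rule for [f] along a curve through [z] with logarithmic velocity
    [p1 + i q1]. *)
Lemma is_derive_along_path (L : R[i] -> R) (f : R[i] -> R[i]^o) z (a : R[i])
    (r K : R) (p q : R -> R) (p1 q1 : R) :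
  contractive_functional L -> 0 < r -> 0 <= K ->
  (forall k, normc k <= r -> normc (f (z + k) - f z - a * k) <= K * normc k ^+ 2) ->
  is_derive (0:R) (1:R) p p1 -> is_derive (0:R) (1:R) q q1 -> p 0 = 0 -> q 0 = 0 ->
  is_derive (0:R) (1:R) (fun h => L (f (z + z * (p h +i* q h))))
    (L (a * z * (p1 +i* q1))).
Proof.
move=> cL r0 K0 fa /is_derive1P dp /is_derive1P dq p0 q0.
have [LD LZ Ln] := cL.
apply/is_derive1P => e e0.
pose N := normc (a * z); have N0 : 0 <= N by exact: normc_nneg.
pose e1 := Num.min 1 (e / (4 * (N + 1))).
have e10 : 0 < e1 by rewrite lt_min ltr01 divr_gt0// mulr_gt0// ltr_wpDl.
have e11 : e1 <= 1 by rewrite ge_min lexx.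
have e1N : e1 * N * 2 <= e / 2.
  have : e1 * (4 * (N + 1)) <= e.
    by rewrite -ler_pdivlMr ?mulr_gt0 ?ltr_wpDl// ge_min lexx orbT.
  by move: e10; clear - N0; nra.
pose X := normc z * (`|p1| + `|q1| + 2).
have X0 : 0 <= X by rewrite mulr_ge0 ?normc_nneg// !addr_ge0.
have dp1 := dp _ e10; have dq1 := dq _ e10.
have KX : 0 < 2 * (K * X ^+ 2 + 1).
  by rewrite mulr_gt0// ltr_wpDl// mulr_ge0// sqr_ge0.
near=> h.
have hr : `|h| * X <= r.
  have : `|h| <= r / (X + 1).
    by near: h; apply: dnbhs0_le; rewrite divr_gt0// ltr_wpDl.
  rewrite ler_pdivlMr ?ltr_wpDl//; apply: le_trans.
  by apply: ler_wpM2l => //; rewrite lerDl.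
have hK : `|h| * (2 * (K * X ^+ 2 + 1)) <= e.
  have : `|h| <= e / (2 * (K * X ^+ 2 + 1)).
    by near: h; apply: dnbhs0_le; rewrite divr_gt0.
  by rewrite ler_pdivlMr.
have ph : `|p h - p1 * h| <= e1 * `|h|.
  have -> : p h - p1 * h = p (0 + h) - p 0 - p1 * h by rewrite add0r p0 subr0.
  by near: h.
have qh : `|q h - q1 * h| <= e1 * `|h|.
  have -> : q h - q1 * h = q (0 + h) - q 0 - q1 * h by rewrite add0r q0 subr0.
  by near: h.
rewrite add0r p0 q0; have -> : (0 +i* 0) = 0 :> R[i] by [].
rewrite mulr0 addr0.
set k := z * (p h +i* q h).
have nk : normc k <= `|h| * X.
  rewrite /k normc_mul /X mulrCA; apply: ler_wpM2l; first exact: normc_nneg.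
  apply: (le_trans (normc_le_abs _ _)).
  have bound (x y : R) : `|x - y * h| <= e1 * `|h| -> `|x| <= (`|y| + 1) * `|h|.
    move=> H; have -> : x = (x - y * h) + y * h by rewrite subrK.
    apply: (le_trans (ler_normD _ _)); rewrite normrM.
    rewrite mulrDl mul1r addrC lerD2l; apply: (le_trans H).
    by rewrite ler_piMl.
  have := lerD (bound _ _ ph) (bound _ _ qh).
  have -> : (`|p1| + 1) * `|h| + (`|q1| + 1) * `|h| =
    `|h| * (`|p1| + `|q1| + 2) by ring.
  by [].
have A1 := fa k (le_trans nk hr).
have E : L (f (z + k)) - L (f z) - L (a * z * (p1 +i* q1)) * h =
    L (f (z + k) - f z - a * k) +
    L (a * z * ((p h - p1 * h) +i* (q h - q1 * h))).
  have -> : a * z * ((p h - p1 * h) +i* (q h - q1 * h)) =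
      a * k - h%:C * (a * z * (p1 +i* q1)).
    have -> : (p h - p1 * h) +i* (q h - q1 * h) =
        (p h +i* q h) - h%:C * (p1 +i* q1) :> R[i].
      by apply/eqP; rewrite eq_complex/= !mul0r subr0 addr0 ![h * _]mulrC !eqxx.
    by rewrite /k; ring.
  by rewrite !(contractiveB _ _ cL) LZ; ring.
rewrite E; apply: (le_trans (ler_normD _ _)).
have B1 : `|L (f (z + k) - f z - a * k)| <= K * X ^+ 2 * `|h| * `|h|.
  apply: (le_trans (Ln _)); apply: (le_trans A1).
  have -> : K * X ^+ 2 * `|h| * `|h| = K * (`|h| * X) ^+ 2 by ring.
  by apply: ler_wpM2l => //; rewrite lerXn2r// ?nnegrE ?normc_nneg// mulr_ge0.
have B2 : `|L (a * z * ((p h - p1 * h) +i* (q h - q1 * h)))| <= e1 * N * 2 * `|h|.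
  apply: (le_trans (Ln _)); rewrite normc_mul -/N.
  have := le_trans (normc_le_abs _ _) (lerD ph qh).
  move=> /(ler_wpM2l N0) /le_trans; apply.
  by rewrite le_eqVlt; apply/orP; left; apply/eqP; ring.
apply: (le_trans (lerD B1 B2)); rewrite -mulrDl; apply: ler_wpM2r => //.
have : K * X ^+ 2 * `|h| <= e / 2.
  have : 0 <= `|h| by [].
  by move: hK; move: (K * X ^+ 2) `|h| => A b; clear; nra.
by move: e1N; clear; lra.
Unshelve. all: by end_near. Qed.

End log_polar.

Section log_polar_harmonic.
Context {R : realType}.

(** The function [f] at the point of logarithm [s + i t]. *)
Definition log_polar (f : R[i] -> R[i]^o) (s t : R) : R[i] :=
  f ((expR s)%:C * expi t).

Lemma normc_expi (t : R) : normc (expi t) = 1.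
Proof. by rewrite /expi /ComplexField.Normc.normc cos2Dsin2 sqrtr1. Qed.

Lemma normc_polar (s t : R) : normc ((expR s)%:C * expi t) = expR s.
Proof. by rewrite normc_mul normc_expi mulr1 normc_real gtr0_norm ?expR_gt0. Qed.

Lemma polar_radial (s h t : R) : (expR (s + h))%:C * expi t =
  (expR s)%:C * expi t + (expR s)%:C * expi t * ((expR h - 1) +i* 0).
Proof.
have -> : (expR h - 1) +i* 0 = (expR h)%:C - 1 :> R[i].
  by apply/eqP; rewrite eq_complex/= subr0 !eqxx.
by rewrite expRD rmorphM/=; ring.
Qed.

Lemma polar_angular (s h t : R) : (expR s)%:C * expi (t + h) =
  (expR s)%:C * expi t + (expR s)%:C * expi t * ((cos h - 1) +i* sin h).
Proof.
have -> : (cos h - 1) +i* sin h = expi h - 1 :> R[i].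
  by apply/eqP; rewrite eq_complex/= subr0 !eqxx.
have -> : expi (t + h) = expi t * expi h :> R[i].
  by apply/eqP; rewrite eq_complex/= cosD sinD [sin t * _ + _]addrC !eqxx.
ring.
Qed.

Lemma is_derive1_shift0 (f : R -> R) (x d : R) :
  is_derive (0:R) (1:R) (fun h => f (x + h)) d -> is_derive x (1:R) f d.
Proof.
move=> /is_derive1P H; apply/is_derive1P => e /H; apply: filterS => h.
by rewrite add0r addr0.
Qed.

(** An approximate square centered at the origin, with vertices [h + o(h)],
    [- h + o(h)] and [+- i h + o(h)], has a small defect as soon as the real parts
    satisfy the two algebraic relations below, which hold for [e ^ h - 1],
    [e ^ -h - 1], [sin h] and [cos h - 1]. *)
Lemma quad_defect_square (z : R[i]) (x y s c h d e : R) :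
  0 < h -> h <= d -> d <= 1 -> 129 * d <= e -> normc z <= 1 ->
  `|x - h| <= d * h -> `|y + h| <= d * h -> `|s - h| <= d * h -> `|c| <= d * h ->
  x + y = - (x * y) -> 2 * c = - s ^+ 2 - c ^+ 2 ->
  [/\ normc (z * (x +i* 0)) <= e, normc (z * (y +i* 0)) <= e,
      normc (z * (c +i* s)) <= e, normc (z * (c +i* - s)) <= e &
      quad_defect (z * (x +i* 0)) (z * (y +i* 0)) (z * (c +i* s))
        (z * (c +i* - s)) <= e * h ^+ 2].
Proof.
move=> h0 hd d1 de z1 X Y S C XY CS.
have d0 : 0 < d by exact: lt_le_trans hd.
have nle (p q : R) : normc (z * (p +i* q)) <= `|p| + `|q|.
  rewrite normc_mul -[leRHS]mul1r; apply: ler_pM => //; try exact: normc_nneg.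
  exact: normc_le_abs.
have dh : 0 <= d * h by rewrite mulr_ge0// ltW.
have dh1 : d * h <= h by rewrite ler_piMl// ltW.
have xh : `|x| <= 2 * h.
  have -> : x = (x - h) + h by rewrite subrK.
  by apply: (le_trans (ler_normD _ _)); rewrite (gtr0_norm h0); lra.
have yh : `|y| <= 2 * h.
  have -> : y = (y + h) - h by rewrite addrK.
  by apply: (le_trans (ler_normB _ _)); rewrite (gtr0_norm h0); lra.
have sh : `|s| <= 2 * h.
  have -> : s = (s - h) + h by rewrite subrK.
  by apply: (le_trans (ler_normD _ _)); rewrite (gtr0_norm h0); lra.
have n1 : normc (z * (x +i* 0)) <= 3 * h.
  by apply: (le_trans (nle _ _)); rewrite normr0 addr0; lra.
have n2 : normc (z * (y +i* 0)) <= 3 * h.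
  by apply: (le_trans (nle _ _)); rewrite normr0 addr0; lra.
have n3 : normc (z * (c +i* s)) <= 3 * h.
  by apply: (le_trans (nle _ _)); lra.
have n4 : normc (z * (c +i* - s)) <= 3 * h.
  by apply: (le_trans (nle _ _)); rewrite normrN; lra.
have h3e : 3 * h <= e by lra.
split; try exact: (le_trans _ h3e).
have real_mul_le (u : R[i]) (v : R) : normc u <= 1 -> normc (u * v%:C) <= `|v|.
  move=> u1; rewrite normc_mul normc_real -[leRHS]mul1r.
  exact: ler_wpM2r.
have zz1 : normc (z ^+ 2) <= 1 by rewrite normc_exp expr_le1// normc_nneg.
rewrite /quad_defect.
have -> : z * (x +i* 0) + z * (y +i* 0) + z * (c +i* s) + z * (c +i* - s) =
    z * (x + y + 2 * c)%:C.
  rewrite -!mulrDr; congr (_ * _).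
  apply/eqP; rewrite eq_complex/= ![_ + 0]addr0 add0r subrr eqxx andbT.
  by apply/eqP; ring.
have -> : (z * (x +i* 0)) ^+ 2 + (z * (y +i* 0)) ^+ 2 + (z * (c +i* s)) ^+ 2 +
    (z * (c +i* - s)) ^+ 2 = z ^+ 2 * (x ^+ 2 + y ^+ 2 + 2 * (c ^+ 2 - s ^+ 2))%:C.
  rewrite !exprMn -!mulrDr; congr (_ * _).
  by apply/eqP; rewrite !expr2 eq_complex/=; apply/andP; split; apply/eqP; ring.
have cube (k : R[i]) : normc k <= 3 * h -> normc k ^+ 3 <= 27 * d * h ^+ 2.
  move=> kh; apply: (@le_trans _ _ ((3 * h) ^+ 3)).
    by rewrite lerXn2r// ?nnegrE ?normc_nneg// mulr_ge0// ltW.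
  have -> : (3 * h) ^+ 3 = 27 * h * h ^+ 2 by ring.
  by apply: ler_wpM2r; [exact: sqr_ge0|lra].
have small (p q P Q : R) : `|p| <= P -> `|q| <= Q -> P * Q <= d * h ^+ 2 ->
    - (d * h ^+ 2) <= p * q <= d * h ^+ 2.
  move=> pP qQ PQ; rewrite -ler_norml normrM; apply: le_trans PQ.
  exact: ler_pM.
have hh : `|h| <= h by rewrite gtr0_norm.
have hd2 : h * (d * h) <= d * h ^+ 2 by rewrite expr2 mulrCA.
have dd2 : d * h * (d * h) <= d * h ^+ 2.
  by apply: le_trans hd2; apply: ler_wpM2r.
have /andP[a1 a1'] := small _ _ _ _ X Y dd2.
have /andP[a2 a2'] := small _ _ _ _ S S dd2.
have /andP[a3 a3'] := small _ _ _ _ C C dd2.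
have /andP[a4 a4'] := small _ _ _ _ X X dd2.
have /andP[a5 a5'] := small _ _ _ _ Y Y dd2.
have /andP[b1 b1'] := small _ _ _ _ hh X hd2.
have /andP[b2 b2'] := small _ _ _ _ hh Y hd2.
have /andP[b3 b3'] := small _ _ _ _ hh S hd2.
have E1 := real_mul_le _ (x + y + 2 * c) z1.
have E2 := real_mul_le _ (x ^+ 2 + y ^+ 2 + 2 * (c ^+ 2 - s ^+ 2)) zz1.
have F1 : `|x + y + 2 * c| <= 7 * (d * h ^+ 2).
  have -> : x + y + 2 * c = - ((x - h) * (y + h)) + h * (x - h) - h * (y + h) -
      (s - h) * (s - h) - 2 * (h * (s - h)) - c * c.
    by rewrite XY CS; ring.
  rewrite ler_norml; move: a1 a1' a2 a2' a3 a3' b1 b1' b2 b2' b3 b3'; clear.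
  move: (d * h ^+ 2) ((x - h) * (y + h)) (h * (x - h)) (h * (y + h))
   ((s - h) * (s - h)) (h * (s - h)) (c * c) => *.
  by apply/andP; split; lra.
have F2 : `|x ^+ 2 + y ^+ 2 + 2 * (c ^+ 2 - s ^+ 2)| <= 14 * (d * h ^+ 2).
  have -> : x ^+ 2 + y ^+ 2 + 2 * (c ^+ 2 - s ^+ 2) = 2 * (h * (x - h)) +
      (x - h) * (x - h) - 2 * (h * (y + h)) + (y + h) * (y + h) + 2 * (c * c) -
      4 * (h * (s - h)) - 2 * ((s - h) * (s - h)) by ring.
  rewrite ler_norml; move: a2 a2' a3 a3' a4 a4' a5 a5' b1 b1' b2 b2' b3 b3'; clear.
  move: (d * h ^+ 2) ((x - h) * (x - h)) (h * (x - h)) (h * (y + h)) ((y + h) * (y + h))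
   ((s - h) * (s - h)) (h * (s - h)) (c * c) => *.
  by apply/andP; split; lra.
apply: (@le_trans _ _ (7 * (d * h ^+ 2) + 14 * (d * h ^+ 2) +
    (27 * d * h ^+ 2 + 27 * d * h ^+ 2 + 27 * d * h ^+ 2 + 27 * d * h ^+ 2))).
  apply: lerD; first by apply: lerD; [exact: le_trans E1 F1|exact: le_trans E2 F2].
  by rewrite !lerD// cube.
have -> : 7 * (d * h ^+ 2) + 14 * (d * h ^+ 2) +
    (27 * d * h ^+ 2 + 27 * d * h ^+ 2 + 27 * d * h ^+ 2 + 27 * d * h ^+ 2) =
    129 * d * h ^+ 2 by ring.
by apply: ler_wpM2r => //; exact: sqr_ge0.
Qed.

Lemma quad_defect_polar (e : R) : 0 < e -> \forall h \near 0^'+,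
  forall z : R[i], normc z <= 1 ->
  [/\ normc (z * ((expR h - 1) +i* 0)) <= e,
      normc (z * ((expR (- h) - 1) +i* 0)) <= e,
      normc (z * ((cos h - 1) +i* sin h)) <= e,
      normc (z * ((cos (- h) - 1) +i* sin (- h))) <= e &
      quad_defect (z * ((expR h - 1) +i* 0)) (z * ((expR (- h) - 1) +i* 0))
        (z * ((cos h - 1) +i* sin h)) (z * ((cos (- h) - 1) +i* sin (- h))) <=
        e * h ^+ 2].
Proof.
move=> e0.
pose d := Num.min 1 (e / 129).
have d0 : 0 < d by rewrite lt_min ltr01 divr_gt0.
have d1 : d <= 1 by rewrite ge_min lexx.
have de : 129 * d <= e by rewrite mulrC -ler_pdivlMr// ge_min lexx orbT.
have He := is_derive1_near_right (is_derive1_expR (0:R)) d0.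
have Hs := is_derive1_near_right (is_derive_sin (0:R)) d0.
have Hc := is_derive1_near_right (is_derive_cos (0:R)) d0.
near=> h => z z1.
have h0 : 0 < h by near: h; exact: nbhs_right_gt.
have hd : h <= d by near: h; exact: nbhs_right_le.
have [X Y] : `|expR (0 + h) - expR 0 - expR 0 * h| <= d * h /\
  `|expR (0 - h) - expR 0 + expR 0 * h| <= d * h by near: h.
have [S _] : `|sin (0 + h) - sin 0 - cos 0 * h| <= d * h /\
  `|sin (0 - h) - sin 0 + cos 0 * h| <= d * h by near: h.
have [C _] : `|cos (0 + h) - cos 0 - (- sin 0) * h| <= d * h /\
  `|cos (0 - h) - cos 0 + (- sin 0) * h| <= d * h by near: h.
rewrite add0r expR0 mul1r in X; rewrite sub0r expR0 mul1r in Y.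
rewrite add0r sin0 cos0 mul1r subr0 in S.
rewrite add0r sin0 cos0 oppr0 mul0r subr0 in C.
rewrite sinN cosN.
have XY : (expR h - 1) + (expR (- h) - 1) = - ((expR h - 1) * (expR (- h) - 1)).
  have : expR h * expR (- h) = 1 by rewrite -expRD subrr expR0.
  by move: (expR h) (expR (- h)) => a b ab; rewrite mulrBl mulrBr ab; ring.
have CS : 2 * (cos h - 1) = - sin h ^+ 2 - (cos h - 1) ^+ 2.
  have := cos2Dsin2 h; move: (cos h) (sin h) => a b ab.
  have -> : b ^+ 2 = 1 - a ^+ 2 by rewrite -ab addrAC subrr add0r.
  by ring.
exact: (quad_defect_square h0 hd d1 de z1 X Y S C XY CS).
Unshelve. all: by end_near. Qed.

Theorem log_polar_harmonic_analytic (f : R[i] -> R[i]^o) (w : R -> R)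
    (L : R[i] -> R) :
  analytic_on (unit_disk R) f -> contractive_functional L ->
  (forall s t : R, s < 0 ->
    normc (derive1 f ((expR s)%:C * expi t)) * expR s <= w s) ->
  log_polar_harmonic (fun s t => L (log_polar f s t)) w.
Proof.
move=> af cL fw; have [LD LZ Ln] := cL.
have indisk (s t : R) : s < 0 -> unit_disk R ((expR s)%:C * expi t).
  by move=> s0; rewrite /unit_disk/= normc_polar expR_lt1.
have path (s t : R) (p q : R -> R) (p1 q1 : R) : s < 0 ->
    is_derive (0:R) (1:R) p p1 -> is_derive (0:R) (1:R) q q1 -> p 0 = 0 -> q 0 = 0 ->
    normc (p1 +i* q1) = 1 ->
    exists2 d, is_derive (0:R) (1:R) (fun h => L (f ((expR s)%:C * expi t +
      (expR s)%:C * expi t * (p h +i* q h)))) d & `|d| <= w s.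
  move=> s0 dp dq p0 q0 n1.
  have [a [r [K [r0 K0 fa _]]]] := analytic_local_estimates af (indisk s t s0).
  have aE := derive1_eq_of_expansion r0 K0 fa.
  eexists; first exact: (is_derive_along_path cL r0 K0 fa dp dq p0 q0).
  apply: (le_trans (Ln _)); rewrite !normc_mul n1 normc_expi !mulr1 normc_real.
  by rewrite gtr0_norm ?expR_gt0// -aE; exact: fw.
split.
- move=> s t; rewrite /log_polar; congr (L (f (_ * _))).
  by rewrite /expi; congr (_ +i* _); rewrite mulr_natl;
    [exact: cosD2pi|exact: sinD2pi].
- move=> s t s0.
  have dp : is_derive (0:R) (1:R) (fun h => expR h - 1) (1:R).
    apply: (is_derive_eq (is_derive1B (is_derive1_expR 0) (is_derive1_cst 1 0))).
    by rewrite expR0 subr0.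
  have [] := path s t _ _ _ _ s0 dp (is_derive1_cst 0 0).
  + by rewrite expR0 subrr.
  + by [].
  + by rewrite -[X in _ = X]normr1 -normc_real.
  + move=> d dV dw; exists d => //; apply: is_derive1_shift0.
    by under eq_fun do rewrite /log_polar polar_radial.
- move=> s t s0.
  have dp : is_derive (0:R) (1:R) (fun h => cos h - 1) (0:R).
    apply: (is_derive_eq (is_derive1B (is_derive_cos 0) (is_derive1_cst 1 0))).
    by rewrite sin0 oppr0 ?subr0 ?addr0.
  have dq : is_derive (0:R) (1:R) sin (1:R).
    by apply: (is_derive_eq (is_derive_sin 0)); rewrite cos0.
  have [] := path s t _ _ _ _ s0 dp dq.
  + by rewrite cos0 subrr.
  + exact: sin0.
  + by rewrite /ComplexField.Normc.normc expr0n/= add0r expr1n sqrtr1.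
  + move=> d dV dw; exists d => //; apply: is_derive1_shift0.
    by under eq_fun do rewrite /log_polar polar_angular.
- move=> s e s0 e0.
  pose z t : R[i] := (expR s)%:C * expi t.
  pose ok (h t : R) := `|L (log_polar f (s + h) t) + L (log_polar f (s - h) t) +
    L (log_polar f s (t + h)) + L (log_polar f s (t - h)) -
    4 * L (log_polar f s t)| <= e * h ^+ 2.
  (* the estimate near each angle becomes uniform by compactness of [[0, 2 pi]] *)
  have cov := (compact_near_coveringP _).1 (@segment_compact R 0 (2 * pi)).
  have : \forall h \near 0^'+, `[0, 2 * pi]%classic `<=` ok h.
    apply: cov => t0 _.
    have [a [r [K [r0 K0 _ fz]]]] := analytic_local_estimates af (indisk s t0 s0).
    pose e1 := Num.min r (e / (K + 1)).
    have e10 : 0 < e1 by rewrite lt_min r0 divr_gt0// ltr_wpDl.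
    have zt : \forall t \near t0, normc (z t - z t0) <= r.
      have c1 : {for t0, continuous (@cos R)} by exact: continuous_cos.
      have c2 : {for t0, continuous (@sin R)} by exact: continuous_sin.
      have r2 : 0 < r / 2 by rewrite divr_gt0.
      move/cvgrPdist_le : c1 => /(_ _ r2) c1; move/cvgrPdist_le : c2 => /(_ _ r2) c2.
      near=> t.
      have -> : z t - z t0 = (expR s)%:C * ((cos t - cos t0) +i* (sin t - sin t0)).
        by rewrite /z -mulrBr; congr (_ * _); apply/eqP; rewrite eq_complex/= !eqxx.
      rewrite normc_mul normc_real gtr0_norm ?expR_gt0//.
      apply: (@le_trans _ _ (1 * (r / 2 + r / 2))); last by lra.
      apply: ler_pM; [exact: expR_ge0|exact: normc_nneg|by rewrite expR_le1 ltW|].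
      apply: (le_trans (normc_le_abs _ _)); apply: lerD.
        by rewrite distrC; near: t.
      by rewrite distrC; near: t.
    refine (ex_intro2 _ _ (_, _) (conj zt (quad_defect_polar e10)) _).
    move=> [t h] /= [zr Hh].
    have zt1 : normc (z t) <= 1 by rewrite /z normc_polar ltW// expR_lt1.
    have [k1 k2 k3 k4 Qh] := Hh _ zt1.
    have e1r : e1 <= r by rewrite ge_min lexx.
    have := fz _ _ _ _ _ zr (le_trans k1 e1r) (le_trans k2 e1r)
      (le_trans k3 e1r) (le_trans k4 e1r).
    rewrite -!polar_radial -!polar_angular.
    move=> /(le_trans (Ln _)).
    rewrite !LD !(contractiveN _ cL) => H.
    rewrite /ok /log_polar -/(z t).
    have -> : forall a b c d x : R,
        a + b + c + d - 4 * x = (a - x) + (b - x) + (c - x) + (d - x).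
      by move=> *; ring.
    apply: (le_trans H).
    apply: (@le_trans _ _ (K * (e1 * h ^+ 2))); first exact: ler_wpM2l.
    rewrite mulrA; apply: ler_wpM2r; first exact: sqr_ge0.
    apply: (@le_trans _ _ ((K + 1) * e1)).
      by apply: ler_wpM2r; [exact: ltW|rewrite lerDl].
    by rewrite mulrC -ler_pdivlMr ?ltr_wpDl// ge_min lexx orbT.
  by apply: filterS => h H t tI; exact: (H t tI).
Unshelve. all: by end_near. Qed.

End log_polar_harmonic.

(** * The weight in logarithmic coordinates *)

Section weight.
Context {R : realType}.
Local Notation mu := (@lebesgue_measure R).

Lemma gint_ge0 (phi : R -> R) x : 0 <= x -> (0 <= gint phi x)%E.
Proof.
move=> x0; apply: integral_ge0 => t /=; rewrite in_itv/= => /andP[xt _].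
by rewrite lee_fin divr_ge0 ?sqr_ge0// ltW// (le_lt_trans x0).
Qed.

Lemma is_derive_gint (phi : R -> R) (x : R)
    (phi_cont : {in `]0, 1[, continuous phi})
    (g_fin : forall x, 0 < x < 1 -> (gint phi x < +oo)%E) : 0 < x < 1 ->
  is_derive x (1:R) (fun x => fine (gint phi x)) (- (phi x ^+ 2 / x)).
Proof.
move=> /andP[x0 x1].
pose h t := phi t ^+ 2 / t.
have ch t : 0 < t < 1 -> {for t, continuous h}.
  move=> /andP[t0 t1]; have cphi : {for t, continuous phi}.
    by apply: phi_cont; rewrite in_itv/= t0 t1.
  apply: cvgM; first by apply: cvgM; exact: cphi.
  by apply: cvgV; [rewrite gt_eqF|exact: cvg_id].
pose a := x / 2.
have a0 : 0 < a by rewrite divr_gt0.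
have ax : a < x by rewrite /a; lra.
have a1 : a < 1 by exact: lt_trans x1.
have ih : mu.-integrable `]a, 1[ (EFin \o h).
  apply/integrableP; split.
    apply/measurable_EFinP; apply: open_continuous_measurable_fun.
      exact: interval_open.
    move=> t /[!inE]/= /[!in_itv]/= /andP[at_ t1]; apply: ch.
    by rewrite (lt_trans a0 at_).
  have : (gint phi a < +oo)%E by apply: g_fin; rewrite a0 a1.
  rewrite /gint; congr (_ < _)%E; apply: eq_integral => t.
  move=> /[!inE]/= /[!in_itv]/= /andP[at_ _].
  by rewrite ger0_norm// divr_ge0 ?sqr_ge0// ltW// (lt_trans a0).
pose F y := \int[mu]_(t in `]a, y]) h t.
have xu : x < (x + 1) / 2 by lra.
have ihu : mu.-integrable `]a, (x + 1) / 2] (EFin \o h).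
  apply: integrableS ih => //; apply: subset_itvl; rewrite bnd_simp; lra.
have ch' : {for x, continuous h} by apply: ch; rewrite x0.
have aBx : (BRight a < BRight x)%O by rewrite bnd_simp.
have [dF FE] := continuous_FTC1 xu ihu aBx ch'.
have dF' : is_derive x (1:R) F (h x) by split; [exact: dF|rewrite -derive1E].
have E : \near x, \int[mu]_(t in `]a, 1[) h t - F x = fine (gint phi x).
  near=> y.
  have ay : a < y by near: y; exact: lt_nbhsr.
  have y1 : y < 1 by near: y; exact: lt_nbhsl.
  rewrite /F (Rintegral_itvB ih) ?bnd_simp//; exact: ltW.
apply: (near_eq_is_derive E).
apply: (is_derive_eq (is_derive1B (is_derive1_cst _ _) dF')).
by rewrite sub0r.
Unshelve. all: by end_near. Qed.

Lemma gint_gt0 (phi : R -> R) (x : R)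
    (phi_cont : {in `]0, 1[, continuous phi})
    (phi_pos : forall t, 0 < t < 1 -> 0 < phi t)
    (g_fin : forall x, 0 < x < 1 -> (gint phi x < +oo)%E) : 0 < x < 1 ->
  0 < fine (gint phi x).
Proof.
move=> /andP[x0 x1]; pose y := (x + 1) / 2.
have xy : x < y by rewrite /y; lra.
have y1 : y < 1 by rewrite /y; lra.
have y0 : 0 < y by exact: lt_trans xy.
apply: (@le_lt_trans _ _ (fine (gint phi y))).
  by apply: fine_ge0; apply: gint_ge0; exact: ltW.
have dg t : x <= t <= y ->
    is_derive t (1:R) (fun x => fine (gint phi x)) (- (phi t ^+ 2 / t)).
  move=> /andP[xt ty]; apply: is_derive_gint => //.
  by rewrite (lt_le_trans x0)// (le_lt_trans ty).
apply: (@ltr0_derive1_decr _ (fun x => fine (gint phi x)) x y) => //.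
- by move=> t /[!in_itv]/= /andP[xt ty]; have [] := dg t; rewrite ?ltW.
- move=> t /[!in_itv]/= /andP[xt ty]; rewrite derive1E.
  have txy : x <= t <= y by rewrite !ltW.
  rewrite (derive_val (is_derive := dg t txy)) oppr_lt0 divr_gt0//.
    by rewrite exprn_gt0// phi_pos// (lt_trans x0)// (lt_trans ty).
  exact: lt_trans xt.
- apply: derivable_within_continuous => t /[!in_itv]/= txy.
  by have [] := dg t txy.
Qed.

(** [log_weight phi s] bounds [|z f'(z)| / B] at [|z| = e ^ s], and [log_gint] is
    [g (1 - |z| ^ 2)]. *)
Definition log_weight (phi : R -> R) (s : R) : R :=
  expR s * phi (1 - expR s ^+ 2) / (1 - expR s ^+ 2).

Definition log_gint (phi : R -> R) (s : R) : R := fine (gint phi (1 - expR s ^+ 2)).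

Lemma sqr_expR_bounds (s : R) : s < 0 -> 0 < 1 - expR s ^+ 2 < 1.
Proof.
move=> s0; have e1 : expR s < 1 by rewrite expR_lt1.
have e0 := expR_gt0 s.
rewrite subr_gt0 expr_lt1 ?ltW// e1/=.
by rewrite gtrBl exprn_gt0.
Qed.

Lemma log_weight_ge0 (phi : R -> R) (phi_pos : forall t, 0 < t < 1 -> 0 < phi t) s :
  s < 0 -> 0 <= log_weight phi s.
Proof.
move=> /sqr_expR_bounds /[dup] /andP[b0 _] b; rewrite divr_ge0 ?(ltW b0)//.
by rewrite mulr_ge0 ?expR_ge0// ltW// phi_pos.
Qed.

Lemma continuous_sqr_expR (s : R) :
  {for s, continuous (fun s : R => 1 - expR s ^+ 2)}.
Proof.
apply: cvgB; first exact: cvg_cst.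
by apply: cvgM; exact: continuous_expR.
Qed.

Lemma continuous_log_weight (phi : R -> R)
    (phi_cont : {in `]0, 1[, continuous phi}) (s : R) : s < 0 ->
  {for s, continuous (log_weight phi)}.
Proof.
move=> s0; have b := sqr_expR_bounds s0; have /andP[b0 _] := b.
apply: cvgM; last first.
  apply: cvgV; first by rewrite gt_eqF.
  exact: continuous_sqr_expR.
apply: cvgM; first exact: continuous_expR.
apply: (@continuous_comp _ _ _ (fun s : R => 1 - expR s ^+ 2) phi).
  exact: continuous_sqr_expR.
by apply: phi_cont; rewrite in_itv.
Qed.

Lemma is_derive_log_gint (phi : R -> R)
    (phi_cont : {in `]0, 1[, continuous phi})
    (g_fin : forall x, 0 < x < 1 -> (gint phi x < +oo)%E) (s : R) : s < 0 ->
  is_derive s (1:R) (log_gint phi) (2 * (1 - expR s ^+ 2) * log_weight phi s ^+ 2).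
Proof.
move=> s0; have b := sqr_expR_bounds s0; have /andP[b0 _] := b.
have d1 : is_derive s (1:R) (fun s => 1 - expR s * expR s) _ :=
  is_derive1B (is_derive1_cst 1 s)
    (is_derive1M (is_derive1_expR s) (is_derive1_expR s)).
have d2 := is_derive_gint phi_cont g_fin b.
have := is_derive1_fcomp (g := fun s => 1 - expR s * expR s) d2 d1.
move=> H; apply: (is_derive_eq H).
rewrite /log_weight.
have b1 : 1 - expR s ^+ 2 != 0 by rewrite gt_eqF.
move: b1; move: (phi _) => p; move: (expR s) => u b1; rewrite -expr2; field.
exact: b1.
Qed.

Lemma sqr_expR_lower (s : R) : -2 <= s < 0 -> 2 / 5 * (- s) <= 1 - expR s ^+ 2.
Proof.
move=> /andP[s2 s0]; have := expR_ge1Dx (- (2 * s)); rewrite expRN => H.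
have p0 : 0 < 1 - 2 * s by lra.
have E : expR (2 * s) <= (1 - 2 * s)^-1.
  by rewrite -[leLHS]invrK lef_pV2// posrE ?invr_gt0 ?expR_gt0//.
have -> : expR s ^+ 2 = expR (2 * s) by rewrite expRM_natl.
rewrite lerBrDr -lerBrDl; apply: (le_trans E).
rewrite -[leLHS]mul1r ler_pdivrMr// -subr_ge0.
have -> : (1 - 2 / 5 * (- s)) * (1 - 2 * s) - 1 = 4 / 5 * (- s * (2 + s)) by field.
by rewrite mulr_ge0// mulr_ge0//; lra.
Qed.

Lemma log_gint_gt0 (phi : R -> R)
    (phi_cont : {in `]0, 1[, continuous phi})
    (phi_pos : forall t, 0 < t < 1 -> 0 < phi t)
    (g_fin : forall x, 0 < x < 1 -> (gint phi x < +oo)%E) (s : R) : s < 0 ->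
  0 < log_gint phi s.
Proof. by move=> /sqr_expR_bounds; exact: gint_gt0. Qed.

Lemma log_gint_nondecreasing (phi : R -> R)
    (phi_cont : {in `]0, 1[, continuous phi})
    (g_fin : forall x, 0 < x < 1 -> (gint phi x < +oo)%E) (s s' : R) :
  s <= s' -> s' < 0 -> log_gint phi s <= log_gint phi s'.
Proof.
move=> ss' s'0.
have dl x : s <= x <= s' -> is_derive x (1:R) (log_gint phi)
    (2 * (1 - expR x ^+ 2) * log_weight phi x ^+ 2).
  by move=> /andP[_ xs']; apply: is_derive_log_gint => //; exact: le_lt_trans s'0.
have d0 x : s <= x <= s' -> is_derive x (1:R) (fun=> 0 : R) 0.
  by move=> _; exact: is_derive1_cst.
have H : forall x, s <= x <= s' ->
    0 <= 2 * (1 - expR x ^+ 2) * log_weight phi x ^+ 2.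
  move=> x /andP[_ xs']; have /andP[b0 _] := sqr_expR_bounds (le_lt_trans xs' s'0).
  by rewrite mulr_ge0 ?sqr_ge0// mulr_ge0// ltW.
have := le_derive_le ss' d0 dl H.
by rewrite subrr subr_ge0.
Qed.

(** The double primitive of the squared weight is controlled by [g]: the
    function [Q s - s P s] has derivative [- s w ^ 2]. *)
Lemma double_primitive_le (phi Q P : R -> R) (B : R)
    (phi_cont : {in `]0, 1[, continuous phi})
    (phi_pos : forall t, 0 < t < 1 -> 0 < phi t)
    (g_fin : forall x, 0 < x < 1 -> (gint phi x < +oo)%E)
    (dQ : forall s : R, -3 < s < 0 -> is_derive s (1:R) Q (P s))
    (dP : forall s : R, -3 < s < 0 ->
      is_derive s (1:R) P ((B * log_weight phi s) ^+ 2))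
    (Q0 : Q (-2) = 0) (P0 : P (-2) = 0) (s : R) :
  -2 <= s < 0 -> Q s <= 2 * B ^+ 2 * log_gint phi s.
Proof.
move=> /andP[s2 s0].
have in3 x : -2 <= x <= s -> -3 < x < 0.
  move=> /andP[x2 xs]; rewrite (le_lt_trans xs s0) andbT (lt_le_trans _ x2)//.
  by rewrite ltrN2 ltr_nat.
have P_ge0 : 0 <= P s.
  have d0 x : -2 <= x <= s -> is_derive x (1:R) (fun=> 0 : R) 0.
    by move=> _; exact: is_derive1_cst.
  have := le_derive_le s2 d0 (fun x xs => dP x (in3 x xs)) (fun x _ => sqr_ge0 _).
  by rewrite subrr P0 subr0.
have d1 x : -2 <= x <= s -> is_derive x (1:R) (fun x => Q x - x * P x)
    (- x * (B * log_weight phi x) ^+ 2).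
  move=> xs; have H := is_derive1B (dQ x (in3 x xs))
    (is_derive1M (is_derive1_id x) (dP x (in3 x xs))).
  by apply: (is_derive_eq H); rewrite /GRing.scale/=; ring.
have d2 x : -2 <= x <= s -> is_derive x (1:R) (fun x => 2 * B ^+ 2 * log_gint phi x)
    (2 * B ^+ 2 * (2 * (1 - expR x ^+ 2) * log_weight phi x ^+ 2)).
  move=> xs; have x0 : x < 0 by have /andP[] := in3 x xs.
  have H := is_derive1M (is_derive1_cst (2 * B ^+ 2) x)
    (is_derive_log_gint phi_cont g_fin x0).
  by apply: (is_derive_eq H); rewrite /GRing.scale/=; ring.
have le12 x : -2 <= x <= s -> - x * (B * log_weight phi x) ^+ 2 <=
    2 * B ^+ 2 * (2 * (1 - expR x ^+ 2) * log_weight phi x ^+ 2).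
  move=> /andP[x2 xs]; have x0 : x < 0 by exact: le_lt_trans s0.
  have x20 : -2 <= x < 0 by rewrite x2.
  have L := sqr_expR_lower x20.
  have -> : 2 * B ^+ 2 * (2 * (1 - expR x ^+ 2) * log_weight phi x ^+ 2) =
    (4 * (1 - expR x ^+ 2)) * (B * log_weight phi x) ^+ 2 by ring.
  by apply: ler_wpM2r; [exact: sqr_ge0|move: L; clear -x0; lra].
have G0 : 0 <= 2 * B ^+ 2 * log_gint phi (-2).
  apply: mulr_ge0; first by rewrite mulr_ge0// sqr_ge0.
  by apply/ltW/log_gint_gt0; rewrite // oppr_lt0.
have sP : 0 <= - s * P s by rewrite mulr_ge0// oppr_ge0 ltW.
have := le_derive_le s2 d1 d2 le12.
rewrite Q0 P0 mulr0 subr0 subr0 => H.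
apply: (@le_trans _ _ (Q s - s * P s)); first by rewrite lerDl -mulNr.
by apply: (le_trans H); rewrite gerBl.
Qed.

End weight.

(** * Bounds along dyadic radii and between them *)

Section dyadic_radii.
Context {R : realType}.
Local Notation prob := (uniform_prob (twopi_gt0 R)).

#[global] Instance circle_ae_filter : Filter (almost_everywhere prob).
Proof. exact: (@ae_filter_ringOfSetsType _ _ R (uniform_prob (twopi_gt0 R))). Qed.

(** The logarithms of the radii at which the exponential means are used. *)
Definition dyadic (k : nat) : R := - 2^-1 ^+ k.+1.

Lemma dyadic_lt0 k : dyadic k < 0.
Proof. by rewrite oppr_lt0 exprn_gt0. Qed.

Lemma dyadic_gtN1 k : -1 < dyadic k.
Proof. by rewrite ltrN2 exprn_ilt1// invf_lt1// ltr1n. Qed.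

Lemma dyadicS k : dyadic k = 2 * dyadic k.+1.
Proof. by rewrite /dyadic [in RHS]exprS mulrN mulVKf. Qed.

Lemma dyadic_le k : dyadic 0 <= dyadic k.
Proof.
by rewrite lerN2 ler_wiXn2l// invf_le1// ler1n.
Qed.

Lemma double_primitive_exists (w : R -> R)
    (w_cont : forall s : R, s < 0 -> {for s, continuous w}) :
  exists Q P : R -> R, [/\
    forall s : R, -3 < s < 0 -> is_derive s (1:R) Q (P s),
    forall s : R, -3 < s < 0 -> is_derive s (1:R) P (w s ^+ 2),
    Q (-2) = 0 & P (-2) = 0].
Proof.
have n54 : -5 < -4 :> R by rewrite ltrN2 ltr_nat.
have n43 : -4 < -3 :> R by rewrite ltrN2 ltr_nat.
have cw2 (x : R) : -5 < x < 0 -> {for x, continuous (fun s => w s ^+ 2)}.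
  by move=> /andP[_ x0]; apply: cvgM; exact: w_cont.
have [P dP] := primitive_exists n54 cw2.
have dP1 (x : R) : -4 < x < 0 ->
    is_derive x (1:R) (fun x => P x - P (-2)) (w x ^+ 2).
  move=> /dP H; apply: (is_derive_eq (is_derive1B H (is_derive1_cst (P (-2)) x))).
  by rewrite subr0.
have cP (x : R) : -4 < x < 0 -> {for x, continuous (fun x => P x - P (-2))}.
  by move=> /dP1; exact: is_derive1_continuous.
have [Q dQ] := primitive_exists n43 cP.
exists (fun x => Q x - Q (-2)), (fun x => P x - P (-2)); split.
- move=> s /dQ H; apply: (is_derive_eq (is_derive1B H (is_derive1_cst (Q (-2)) s))).
  by rewrite subr0.
- by move=> s /andP[s3 s0]; apply: dP1; rewrite s0 (lt_trans n43).
- exact: subrr.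
- exact: subrr.
Qed.

Lemma weightB_ge0 (phi : R -> R)
    (phi_pos : forall t, 0 < t < 1 -> 0 < phi t) (B : R) : 0 < B ->
  forall s : R, s < 0 -> 0 <= B * log_weight phi s.
Proof. by move=> B0 s s0; rewrite mulr_ge0 ?log_weight_ge0// ltW. Qed.

Lemma weightB_cont (phi : R -> R)
    (phi_cont : {in `]0, 1[, continuous phi}) (B : R) (s : R) : s < 0 ->
  {for s, continuous (fun s => B * log_weight phi s)}.
Proof.
by move=> s0; apply: cvgM; [exact: cvg_cst|exact: continuous_log_weight].
Qed.

Lemma dyadic_upper_bound (phi : R -> R)
    (phi_cont : {in `]0, 1[, continuous phi})
    (phi_pos : forall t, 0 < t < 1 -> 0 < phi t)
    (g_fin : forall x, 0 < x < 1 -> (gint phi x < +oo)%E)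
    (V : R -> R -> R) (B : R) : 0 < B ->
  log_polar_harmonic V (fun s => B * log_weight phi s) ->
  {ae prob, forall t, \forall k \near \oo,
    V (dyadic k) t <= 12 * B * ln k.+1%:R * Num.sqrt (log_gint phi (dyadic k))}.
Proof.
move=> B0 lphV.
have w0 := weightB_ge0 phi_pos B0; have wc := @weightB_cont _ phi_cont B.
have [Q [P [dQ dP Q0 P0]]] := double_primitive_exists wc.
have [M M0 VM] := lph_bounded lphV wc.
have G0 k : 0 < log_gint phi (dyadic k).
  by apply: log_gint_gt0 => //; exact: dyadic_lt0.
have sG0 k : 0 < Num.sqrt (log_gint phi (dyadic k)) by rewrite sqrtr_gt0.
(* with this choice [8 c k ^ 2 Q (dyadic k) <= 16 / 36] *)
pose c k := (6 * B * Num.sqrt (log_gint phi (dyadic k)))^-1.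
have B6 : 0 < 6 * B by rewrite mulr_gt0.
have cpos k : 6 * B * Num.sqrt (log_gint phi (dyadic k)) \is Num.pos.
  by rewrite posrE; exact: mulr_gt0.
have c0 k : 0 < c k by rewrite invr_gt0 -posrE.
have ck0 k : c k <= c 0%N.
  rewrite /c (lef_pV2 (cpos k) (cpos 0%N)); apply: ler_wpM2l; first exact: ltW.
  rewrite ler_sqrt; last exact: ltW.
  by apply: log_gint_nondecreasing => //; [exact: dyadic_le|exact: dyadic_lt0].
have cQ k : 8 * c k ^+ 2 * Q (dyadic k) <= 2^-1.
  have d2 : -2 <= dyadic k < 0.
    rewrite dyadic_lt0 andbT; apply: le_trans (ltW (dyadic_gtN1 k)).
    by rewrite lerN2 ler1n.
  have H := double_primitive_le phi_cont phi_pos g_fin dQ dP Q0 P0 d2.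
  have c8 : 0 <= 8 * c k ^+ 2 by rewrite mulr_ge0// sqr_ge0.
  apply: (le_trans (ler_wpM2l c8 H)).
  rewrite /c exprVn !exprMn sqr_sqrtr; last exact: ltW.
  have -> : 8 * (6 ^+ 2 * B ^+ 2 * log_gint phi (dyadic k))^-1 *
      (2 * B ^+ 2 * log_gint phi (dyadic k)) = 4 / 9.
    by have := G0 k; move: (log_gint phi _) => g g0; field; rewrite !gt_eqF.
  lra.
have JC k : exp_mean V (c k) (dyadic k) <= 4 * (2 * pi * expR (c 0%N * M)).
  apply: (exp_mean_bound lphV w0 wc dQ dP Q0 P0 _ (ltW (c0 k)) (cQ k)).
    by rewrite dyadic_gtN1 dyadic_lt0.
  move=> s s21; have s0 : s < 0.
    by case/andP: s21 => _ s1; apply: le_lt_trans s1 _; rewrite oppr_lt0.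
  apply: (le_trans (exp_mean_le lphV (ltW (c0 k)) s0 (VM s ^~ s21))).
  apply: ler_wpM2l; first by rewrite ltW// twopi_gt0.
  by rewrite ler_expR; exact: ler_wpM2r.
have := exp_mean_borel_cantelli lphV c0 dyadic_lt0 JC.
apply: filterS => t; apply: filterS => k; rewrite /c invrK.
by move=> /le_trans; apply; rewrite le_eqVlt; apply/orP; left; apply/eqP; ring.
Qed.

Lemma dyadic_oscillation (phi : R -> R)
    (phi_cont : {in `]0, 1[, continuous phi})
    (phi_pos : forall t, 0 < t < 1 -> 0 < phi t)
    (g_fin : forall x, 0 < x < 1 -> (gint phi x < +oo)%E)
    (V : R -> R -> R) (B : R) : 0 < B ->
  log_polar_harmonic V (fun s => B * log_weight phi s) ->
  forall k s t, dyadic k <= s <= dyadic k.+1 ->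
    `|V s t - V (dyadic k) t| <= 2 * B * Num.sqrt (log_gint phi s).
Proof.
move=> B0 lphV k s t /andP[ks sk].
have s0 : s < 0 by exact: le_lt_trans sk (dyadic_lt0 _).
have Gs : 0 < log_gint phi s by exact: (log_gint_gt0 phi_cont phi_pos g_fin).
set m := Num.sqrt (log_gint phi s).
have m0 : 0 < m by rewrite sqrtr_gt0.
have mG : m ^+ 2 = log_gint phi s by rewrite sqr_sqrtr// ltW.
pose d := - dyadic k.+1.
have d0 : 0 < d by rewrite oppr_gt0 dyadic_lt0.
(* [p' x >= B u], with [u = log_weight phi x], follows from
   [2 u <= (d / m) u ^ 2 + m / d] and [d <= - x] *)
pose p x := B / 2 * (5 / 4 / m * log_gint phi x + m / d * x).
pose p' x := B / 2 *
  (5 / 4 / m * (2 * (1 - expR x ^+ 2) * log_weight phi x ^+ 2) + m / d).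
have dp x : dyadic k <= x <= s -> is_derive x (1:R) p (p' x).
  move=> /andP[_ xs]; have x0 : x < 0 by exact: le_lt_trans s0.
  have H := is_derive1M (is_derive1_cst (B / 2) x)
    (is_derive1D (is_derive1M (is_derive1_cst (5 / 4 / m) x)
      (is_derive_log_gint phi_cont g_fin x0))
      (is_derive1M (is_derive1_cst (m / d) x) (is_derive1_id x))).
  by apply: (is_derive_eq H); rewrite /p' /GRing.scale/=; ring.
have wp x : dyadic k <= x <= s -> B * log_weight phi x <= p' x.
  move=> /andP[kx xs]; have x0 : x < 0 by exact: le_lt_trans s0.
  have x2 : -2 <= x < 0.
    rewrite x0 andbT (le_trans _ kx)//; apply: le_trans (ltW (dyadic_gtN1 k)).
    by rewrite lerN2 ler1n.
  have L := sqr_expR_lower x2.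
  have dx : d <= - x by rewrite lerN2 (le_trans xs).
  have wx := log_weight_ge0 phi_pos x0.
  rewrite /p' -mulrA; apply: ler_wpM2l; first exact: ltW.
  move: wx L; set u := log_weight phi x; set v := 1 - _ => wx L.
  have A1 : 2 / 5 * d <= v by apply: le_trans L; apply: ler_wpM2l.
  rewrite mulrC ler_pdivlMr//.
  apply: (@le_trans _ _ (d / m * u ^+ 2 + m / d)).
    have E : d / m * u ^+ 2 + m / d - u * 2 = d / m * (u - m / d) ^+ 2.
      by field; rewrite !gt_eqF.
    by rewrite -subr_ge0 E mulr_ge0 ?sqr_ge0// divr_ge0// ltW.
  rewrite lerD2r.
  have -> : 5 / 4 / m * (2 * v * u ^+ 2) = (5 / 2 * v) / m * u ^+ 2.
    by field; rewrite gt_eqF.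
  apply: ler_wpM2r; first exact: sqr_ge0.
  apply: ler_wpM2r; first by rewrite invr_ge0 ltW.
  by move: A1; clear; lra.
apply: (le_trans (lph_radial_osc lphV t ks s0 dp wp)).
have Gk : 0 <= log_gint phi (dyadic k).
  by apply/ltW/log_gint_gt0 => //; exact: dyadic_lt0.
have B2 : 0 <= B / 2 by rewrite divr_ge0// ltW.
have sd : s - dyadic k <= d.
  by have := sk; rewrite (dyadicS k) /d; clear; lra.
rewrite /p -mulrBr.
have -> : 5 / 4 / m * log_gint phi s + m / d * s -
    (5 / 4 / m * log_gint phi (dyadic k) + m / d * dyadic k) =
  5 / 4 * m - 5 / 4 / m * log_gint phi (dyadic k) + m / d * (s - dyadic k).
  by rewrite -mG; field; rewrite !gt_eqF.
have C1 : m / d * (s - dyadic k) <= m.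
  by rewrite mulrAC -mulrA ler_piMr ?(ltW m0)// ler_pdivrMr// mul1r.
have C2 : 0 <= 5 / 4 / m * log_gint phi (dyadic k).
  by rewrite mulr_ge0// divr_ge0// ltW.
apply: (@le_trans _ _ (B / 2 * (4 * m))).
  by apply: ler_wpM2l => //; move: C1 C2 m0; clear; lra.
by rewrite le_eqVlt; apply/orP; left; apply/eqP; field.
Qed.

End dyadic_radii.

(** * The growth estimate *)

Section growth.
Context {R : realType}.
Local Notation prob := (uniform_prob (twopi_gt0 R)).

Lemma dyadic_bracket (k1 : nat) (s : R) : dyadic k1 <= s -> s < 0 ->
  exists2 k, (k1 <= k)%N & dyadic k <= s <= dyadic k.+1.
Proof.
move=> k1s s0.
have c : (fun n => (2^-1 : R) ^+ n) @ \oo --> (0 : R).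
  by apply: cvg_expr; rewrite ger0_norm// invf_lt1// ltr1n.
have ns0 : 0 < - s by rewrite oppr_gt0.
have [n _ Hn] : \forall n \near \oo, (2^-1 : R) ^+ n <= - s.
  move/cvgrPdist_le : c => /(_ _ ns0); apply: filterS => n.
  by rewrite sub0r normrN ger0_norm// exprn_ge0.
have ex : exists k, (k1 <= k)%N && (s <= dyadic k.+1).
  exists (maxn k1 n); rewrite leq_maxl/= lerNr; apply: Hn => /=.
  by rewrite (leq_trans (leq_maxr k1 n))// -addn2 leq_addr.
case: (ex_minnP ex) => k /andP[k1k sk] kmin; exists k => //.
rewrite sk andbT; move: k1k; rewrite leq_eqVlt => /predU1P[<-//|].
case: k sk kmin => // k sk kmin k1k.
rewrite leNgt; apply/negP => sk'.
have := kmin k; rewrite -ltnS k1k (ltW sk') => /(_ isT).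
by rewrite ltnn.
Qed.

Lemma ln2_ge_half : 2^-1 <= ln 2 :> R.
Proof.
rewrite -[leLHS]expRK ler_ln ?posrE ?expR_gt0//.
have := expR_ge1Dx (- (2^-1) : R); rewrite expRN => H.
rewrite -[leLHS]invrK -[leRHS]invrK lef_pV2 ?posrE ?invr_gt0 ?expR_gt0//.
by apply: le_trans H; lra.
Qed.

(** [log |log (1 - r)|] is at least half the logarithm of the index of the
    dyadic radius below [r = e ^ s]. *)
Lemma lnln_lower (k : nat) (s : R) : (3 <= k)%N -> dyadic k <= s -> s < 0 ->
  ln k.+1%:R <= 2 * ln `|ln (1 - expR s)| /\ 1 <= ln k.+1%:R :> R.
Proof.
move=> k3 ks s0.
have N4 : 4 <= k.+1%:R :> R by rewrite ler_nat.
set N := k.+1%:R in N4 *.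
have N0 : 0 < N by lra.
have r1 : 0 < 1 - expR s by rewrite subr_gt0 expR_lt1.
have l2 := ln2_ge_half.
have A : ln (1 - expR s) <= - (N * ln 2).
  apply: (@le_trans _ _ (ln (2^-1 ^+ k.+1))).
    rewrite ler_ln ?posrE ?exprn_gt0//.
    have := expR_ge1Dx s; move: ks; rewrite /dyadic => ks H.
    by move: ks H; move: (2^-1 ^+ k.+1) => a; clear; lra.
  by rewrite lnXn// lnV ?posrE// mulNrn mulr_natl.
have B : N / 2 <= `|ln (1 - expR s)|.
  rewrite ler0_norm; last first.
    by apply: (le_trans A); rewrite oppr_le0 mulr_ge0 ?ltW//; lra.
  rewrite lerNr; apply: (le_trans A); rewrite lerN2.
  by apply: ler_wpM2l => //; exact: ltW.
have lnN : ln N <= 2 * ln (N / 2).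
  rewrite mulr_natl -lnXn ?divr_gt0// ler_ln ?posrE ?exprn_gt0 ?divr_gt0//.
  by rewrite expr2; nra.
split.
  apply: (le_trans lnN); rewrite ler_pM2l// ler_ln ?posrE ?divr_gt0//.
  by apply: lt_le_trans B; rewrite divr_gt0.
apply: (@le_trans _ _ (ln (2 ^+ 2))); first by rewrite lnXn// mulr2n; lra.
by rewrite ler_ln ?posrE// expr2; lra.
Qed.

Lemma analytic_weight_bound (phi : R -> R) (f : R[i] -> R[i]^o) (B : R)
    (phi_pos : forall t, 0 < t < 1 -> 0 < phi t) :
  (forall z, unit_disk R z -> z <> 0 ->
    (1 - normc z ^+ 2) * normc (derive1 f z) / phi (1 - normc z ^+ 2) <= B) ->
  forall s t : R, s < 0 ->
    normc (derive1 f ((expR s)%:C * expi t)) * expR s <= B * log_weight phi s.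
Proof.
move=> fB s t s0; have b := sqr_expR_bounds s0; have /andP[b0 _] := b.
have := fB ((expR s)%:C * expi t); rewrite normc_polar.
have zD : unit_disk R ((expR s)%:C * expi t).
  by rewrite /unit_disk/= normc_polar expR_lt1.
have z0 : (expR s)%:C * expi t <> 0.
  by move=> z0; have := expR_gt0 s; rewrite -(normc_polar s t) z0 normc_zero ltxx.
move=> /(_ zD z0); rewrite ler_pdivrMr ?phi_pos// /log_weight => H.
move: H b0 (expR_ge0 s); move: (expR s) (1 - _) (phi _) (normc _) => e b1 p n H b0 e0.
have -> : B * (e * p / b1) = e * (B * p) / b1 by ring.
rewrite ler_pdivlMr//; have -> : n * e * b1 = e * (b1 * n) by ring.
exact: ler_wpM2l.
Qed.

(** Arithmetic of the final estimate: [u] and [v] are the values of [f] at a point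
    and at the dyadic radius below it, [m] and [m'] the corresponding values of
    [sqrt g]. *)
Lemma growth_arith (u v : R[i]) (B D N m m' : R) : 0 < B -> 0 < m -> m' <= m ->
  N <= 2 * D -> 1 <= N ->
  complex.Re v <= 12 * B * N * m' -> - complex.Re v <= 12 * B * N * m' ->
  complex.Im v <= 12 * B * N * m' -> - complex.Im v <= 12 * B * N * m' ->
  `|complex.Re u - complex.Re v| <= 2 * B * m ->
  `|complex.Im u - complex.Im v| <= 2 * B * m ->
  normc u / (D * m) <= 56 * B.
Proof.
move=> B0 m0 mm ND N1 a1 a2 a3 a4 o1 o2.
have D0 : 0 < D by move: ND N1; clear; lra.
have N0 : 0 < N by exact: lt_le_trans N1.
have Dm : 0 < D * m by exact: mulr_gt0.
have BN : 12 * B * N * m' <= 12 * B * N * m.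
  by apply: ler_wpM2l => //; apply: mulr_ge0; [apply: mulr_ge0|]; rewrite ?ltW.
have bound (x y : R) : x <= 12 * B * N * m' -> - x <= 12 * B * N * m' ->
    `|y - x| <= 2 * B * m -> `|y| <= 2 * B * m + 12 * B * N * m.
  move=> h1 h2 yx; have -> : y = (y - x) + x by rewrite subrK.
  apply: (le_trans (ler_normD _ _)); apply: lerD => //; apply: le_trans BN.
  by rewrite ler_norml lerNl h1 h2.
have X := bound _ _ a1 a2 o1; have Y := bound _ _ a3 a4 o2.
have nle : normc u <= `|complex.Re u| + `|complex.Im u|.
  by case: (u) => x y; exact: normc_le_abs.
rewrite ler_pdivrMr//; apply: (le_trans nle); apply: (le_trans (lerD X Y)).
have -> : 2 * B * m + 12 * B * N * m + (2 * B * m + 12 * B * N * m) =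
  B * m * (4 + 24 * N) by ring.
have -> : 56 * B * (D * m) = B * m * (56 * D) by ring.
apply: ler_wpM2l; first by rewrite ltW// mulr_gt0.
by move: ND N1; clear; lra.
Qed.

(** The almost everywhere bound, in terms of any positive bound [B] for the norm
    of [f]. *)
Lemma growth_ae (phi : R -> R) (f : R[i] -> R[i]^o) (B : R)
    (phi_cont : {in `]0, 1[, continuous phi})
    (phi_pos : forall t, 0 < t < 1 -> 0 < phi t)
    (g_fin : forall x, 0 < x < 1 -> (gint phi x < +oo)%E) : 0 < B ->
  analytic_on (unit_disk R) f ->
  (forall z, unit_disk R z -> z <> 0 ->
    (1 - normc z ^+ 2) * normc (derive1 f z) / phi (1 - normc z ^+ 2) <= B) ->
  circle_ae (fun zeta : R[i] =>
    (limf_esup (fun r : R => (normc (f (r%:C * zeta))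
       / (ln `|ln (1 - r)| * Num.sqrt (fine (gint phi (1 - r ^+ 2)))))%:E) 1^'-
     <= (56 * B)%:E)%E).
Proof.
move=> B0 af fB.
have fw := analytic_weight_bound phi_pos fB.
have hRe := log_polar_harmonic_analytic af (@contractive_Re R) fw.
have hIm := log_polar_harmonic_analytic af (@contractive_Im R) fw.
have u1 := dyadic_upper_bound phi_cont phi_pos g_fin B0 hRe.
have u2 := dyadic_upper_bound phi_cont phi_pos g_fin B0 (log_polar_harmonicN hRe).
have u3 := dyadic_upper_bound phi_cont phi_pos g_fin B0 hIm.
have u4 := dyadic_upper_bound phi_cont phi_pos g_fin B0 (log_polar_harmonicN hIm).
apply: (filterS _ (filterI (filterI u1 u2) (filterI u3 u4))) => t [[v1 v2] [v3 v4]].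
have [k0 _ Hk0] := filterI (filterI v1 v2) (filterI v3 v4).
pose k1 := maxn 3 k0.
rewrite limf_esupE.
apply: (@le_trans _ _ (ereal_sup [set (normc (f (r%:C * expi t))
  / (ln `|ln (1 - r)| * Num.sqrt (fine (gint phi (1 - r ^+ 2)))))%:E |
    r in [set r | expR (dyadic k1) <= r < 1]])).
  apply: ereal_inf_lbound; exists [set r | expR (dyadic k1) <= r < 1] => //.
  near=> r; apply/andP; split.
    by near: r; apply: nbhs_left_ge; rewrite expR_lt1 dyadic_lt0.
  by near: r; exact: nbhs_left_lt.
apply: ge_ereal_sup => _ [r /= /andP[rk r1] <-].
rewrite lee_fin.
have r0 : 0 < r by exact: lt_le_trans (expR_gt0 _) rk.
have [s sr] := expR_total r0; rewrite -sr in rk r1 *.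
rewrite ler_expR in rk; rewrite expR_lt1 in r1.
have [k k1k /andP[ks sk]] := dyadic_bracket rk r1.
have k3 : (3 <= k)%N by apply: leq_trans k1k; exact: leq_maxl.
have k0k : (k0 <= k)%N by apply: leq_trans k1k; exact: leq_maxr.
have [[a1 a2] [a3 a4]] := Hk0 k k0k.
have [lnN ln1] := lnln_lower k3 ks r1.
have ksk : dyadic k <= s <= dyadic k.+1 by rewrite ks.
have o1 := dyadic_oscillation phi_cont phi_pos g_fin B0 hRe t ksk.
have o2 := dyadic_oscillation phi_cont phi_pos g_fin B0 hIm t ksk.
have Gs := log_gint_gt0 phi_cont phi_pos g_fin r1.
rewrite -/(log_gint phi s) -/(log_polar f s t).
have m0 : 0 < Num.sqrt (log_gint phi s) by rewrite sqrtr_gt0.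
have mk : Num.sqrt (log_gint phi (dyadic k)) <= Num.sqrt (log_gint phi s).
  by rewrite ler_sqrt; [exact: log_gint_nondecreasing|exact: ltW].
exact: (growth_arith B0 m0 mk lnN ln1 a1 a2 a3 a4 o1 o2).
Unshelve. all: by end_near. Qed.

End growth.

Theorem theorem3 (R : realType) (phi : R -> R)
    (phi_cont : {in `]0, 1[, continuous phi})
    (phi_pos : forall t, 0 < t < 1 -> 0 < phi t)
    (g_fin : forall x, 0 < x < 1 -> (gint phi x < +oo)%E) :
  exists gamma1 : R, forall f : R[i] -> R[i]^o,
    Bspace phi f -> f 0 = 0 ->
    circle_ae (fun zeta : R[i] =>
      (limf_esup
         (fun r : R =>
            (normc (f (r%:C * zeta))
             / (ln `|ln (1 - r)| * Num.sqrt (fine (gint phi (1 - r ^+ 2)))))%:E)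
         1^'-
       <= gamma1%:E * Bnorm phi f)%E).
Proof.
exists 56 => f [af fB] _.
pose q z := (1 - normc z ^+ 2) * normc (derive1 f z) / phi (1 - normc z ^+ 2).
have q_le z : unit_disk R z -> z <> 0 -> ((q z)%:E <= Bnorm phi f)%E.
  by move=> zD z0; apply: ereal_sup_ubound; exists z.
have B0 : (0 <= Bnorm phi f)%E.
  have h0 : 0 < (2^-1 : R) by rewrite invr_gt0.
  have nh : normc (2^-1 : R)%:C = 2^-1 :> R by rewrite normc_real gtr0_norm.
  have hD : unit_disk R (2^-1)%:C by rewrite /unit_disk/= nh invf_lt1// ltr1n.
  have hn0 : (2^-1 : R)%:C <> 0 :> R[i].
    by move=> H; move: h0; rewrite -nh H normc_zero ltxx.
  apply: le_trans (q_le _ hD hn0); rewrite lee_fin /q nh.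
  have b : 0 < (1 - 2^-1 ^+ 2 : R) < 1 by apply/andP; split; lra.
  rewrite divr_ge0//; last by rewrite ltW// phi_pos.
  by rewrite mulr_ge0 ?normc_nneg//; case/andP: b => /ltW.
have Bfin : Bnorm phi f \is a fin_num by rewrite ge0_fin_numE.
set b := fine (Bnorm phi f).
have bE : Bnorm phi f = b%:E by rewrite /b fineK.
have b0 : 0 <= b by exact: fine_ge0.
have qb z : unit_disk R z -> z <> 0 -> q z <= b.
  by move=> zD z0; rewrite -lee_fin -bE; exact: q_le.
(* [growth_ae] needs a positive bound, while [b] vanishes when [f] is constant *)
have H n : circle_ae (fun zeta : R[i] =>
      (limf_esup
         (fun r : R =>
            (normc (f (r%:C * zeta))
             / (ln `|ln (1 - r)| * Num.sqrt (fine (gint phi (1 - r ^+ 2)))))%:E)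
         1^'-
       <= (56 * (b + n.+1%:R^-1))%:E)%E).
  apply: growth_ae => //.
    by rewrite ltr_wpDl// invr_gt0.
  move=> z zD z0; apply: (le_trans (qb z zD z0)).
  by rewrite lerDl invr_ge0.
rewrite /circle_ae; have := ae_foralln H.
apply: filterS => t Ht; rewrite bE -EFinM.
apply/lee_addgt0Pr => e e0.
have e56 : 0 < e / 56 by rewrite divr_gt0.
have [n _ /(_ n (leqnn n)) nS] := near_infty_natSinv_lt (PosNum e56).
apply: (le_trans (Ht n)); rewrite -EFinD lee_fin mulrDr lerD2l mulrC.
by rewrite -ler_pdivlMr// ltW.
Qed.
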